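(* Let $\alpha:\mathbb T^2\to\mathbb R^3$ be an immersed canal surface, with center along a smooth bi-regular closed curve $\mathbf c$ in $\mathbb R^3$ and with radial function $r$. Then $\alpha$ has at most two isolated periodic principal lines.
   Context: Let $\mathbf c$ be a smooth $L$-periodic closed curve in $\mathbb R^3$ parametrized by arc length $s$, with $\mathbf c'=\mathbf t$, $|\mathbf t|=1$, and bi-regular, i.e. with curvature $\kappa(s)=|\mathbf t'(s)|>0$. Its Frenet frame $\{\mathbf t,\mathbf n,\mathbf b\}$, with $\mathbf b=\mathbf t\wedge\mathbf n$, is the positive orthonormal frame satisfying $\mathbf t'=\kappa\mathbf n$, $\mathbf n'=-\kappa\mathbf t+\tau\mathbf b$, $\mathbf b'=-\tau\mathbf n$. Let $r(s)>0$ and $\theta(s)\in\,]0,\pi[$ be smooth $L$-periodic functions. The mapping $\alpha:\mathbb T^2=\mathbb S^1\times\mathbb S^1\to\mathbb R^3$, defined on $\mathbb R^2$ modulo $L\times2\pi$ by $$\alpha(s,\varphi)=\mathbf c(s)+r(s)\cos\theta(s)\,\mathbf t(s)+r(s)\sin\theta(s)\,[\cos\varphi\,\mathbf n(s)+\sin\varphi\,\mathbf b(s)],$$ is called an immersed canal surface with center along $\mathbf c$ and radial function $r$ if for all $s$ $$\cos\theta(s)=-r'(s)\quad\text{and}\quad\kappa(s)<\frac{1-r'(s)^2-r(s)r''(s)}{r(s)\sqrt{1-r'(s)^2}}.$$ (Such an $\alpha$ is an immersion.) Principal lines are the maximal integral curves, on $\mathbb T^2$, of the two principal direction fields of $\alpha$;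 these form the maximal and the minimal principal foliations, according to whether they correspond to the larger or the smaller principal curvature with respect to the inward unit normal $N_\alpha=(\mathbf c(s)-\alpha(s,\varphi))/r(s)$. A tangent vector $v\ne0$ is a principal direction with principal curvature $k$ if $dN_\alpha(v)+k\,d\alpha(v)=0$. A principal line is periodic if it is a closed curve. A periodic principal line is isolated if it has a neighborhood in $\mathbb T^2$ containing no other periodic principal line of the same principal foliation. *)

(* Defs.v *)
From Stdlib Require Export Reals ZArith.
From Coquelicot Require Export Coquelicot.
Open Scope R_scope.

Definition R2 : Type := (R * R)%type.
Definition R3 : Type := (R * R * R)%type.

Definition dot (u v : R3) : R :=
  fst (fst u) * fst (fst v) + snd (fst u) * snd (fst v) + snd u * snd v.

Definition cross (u v : R3) : R3 :=
  (snd (fst u) * snd v - snd u * snd (fst v),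
   snd u * fst (fst v) - fst (fst u) * snd v,
   fst (fst u) * snd (fst v) - snd (fst u) * fst (fst v)).

Definition enorm (u : R3) : R := sqrt (dot u u).

(* [Derive] is total, so these are meaningful only for differentiable
   arguments; this is always guaranteed where they are used. *)
Definition Derive2 (f : R -> R2) (x : R) : R2 :=
  (Derive (fun y => fst (f y)) x, Derive (fun y => snd (f y)) x).

Definition Derive3 (f : R -> R3) (x : R) : R3 :=
  (Derive (fun y => fst (fst (f y))) x,
   Derive (fun y => snd (fst (f y))) x,
   Derive (fun y => snd (f y)) x).

(* The differential at [p] applied to [v], through the Jacobian matrix. *)
Definition differential (F : R2 -> R3) (p v : R2) : R3 :=
  plus (scal (fst v) (Derive3 (fun s => F (s, snd p)) (fst p)))
       (scal (snd v) (Derive3 (fun phi => F (fst p, phi)) (snd p))).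

Definition smooth (f : R -> R) : Prop := forall n x, ex_derive_n f n x.

Definition smooth3 (f : R -> R3) : Prop :=
  smooth (fun x => fst (fst (f x))) /\
  smooth (fun x => snd (fst (f x))) /\
  smooth (fun x => snd (f x)).

Definition periodic {A : Type} (L : R) (f : R -> A) : Prop :=
  forall x, f (x + L) = f x.

(* Frenet frame of an arc length parametrized curve. The torsion is then
   determined by the frame and does not enter the parametrization below. *)
Definition tangent (c : R -> R3) : R -> R3 := Derive3 c.
Definition curvature (c : R -> R3) (s : R) : R := enorm (Derive3 (tangent c) s).
Definition normal (c : R -> R3) (s : R) : R3 :=
  scal (/ curvature c s) (Derive3 (tangent c) s).
Definition binormal (c : R -> R3) (s : R) : R3 :=
  cross (tangent c s) (normal c s).

Definition biregular_closed_curve (L : R) (c : R -> R3) : Prop :=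
  0 < L /\ smooth3 c /\ periodic L c /\
  (forall s, enorm (tangent c s) = 1) /\
  (forall s, 0 < curvature c s).

(* Points [p = (s, phi)] of R^2 represent points of the torus. *)
Definition canal (c : R -> R3) (r theta : R -> R) (p : R2) : R3 :=
  let (s, phi) := p in
  plus (plus (c s) (scal (r s * cos (theta s)) (tangent c s)))
       (scal (r s * sin (theta s))
             (plus (scal (cos phi) (normal c s))
                   (scal (sin phi) (binormal c s)))).

Definition immersed_canal_surface
    (L : R) (c : R -> R3) (r theta : R -> R) : Prop :=
  biregular_closed_curve L c /\
  smooth r /\ periodic L r /\ (forall s, 0 < r s) /\
  smooth theta /\ periodic L theta /\ (forall s, 0 < theta s < PI) /\
  (forall s, cos (theta s) = - Derive r s) /\
  (forall s, curvature c s <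
     (1 - (Derive r s) ^ 2 - r s * Derive_n r 2 s)
     / (r s * sqrt (1 - (Derive r s) ^ 2))).

Definition inward_normal (c : R -> R3) (r theta : R -> R) (p : R2) : R3 :=
  scal (/ r (fst p)) (minus (c (fst p)) (canal c r theta p)).

Definition principal_direction (c : R -> R3) (r theta : R -> R)
    (p v : R2) (k : R) : Prop :=
  v <> (0, 0) /\
  plus (differential (inward_normal c r theta) p v)
       (scal k (differential (canal c r theta) p v)) = (0, 0, 0).

Definition principal_curvature (c : R -> R3) (r theta : R -> R)
    (p : R2) (k : R) : Prop :=
  exists v, principal_direction c r theta p v k.

Inductive foliation : Type := Maximal | Minimal.

Definition foliation_direction (c : R -> R3) (r theta : R -> R)
    (F : foliation) (p v : R2) : Prop :=
  exists k, principal_direction c r theta p v k /\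
    forall k', principal_curvature c r theta p k' ->
      match F with Maximal => k' <= k | Minimal => k <= k' end.

(* The torus is R^2 modulo [L x 2 PI]. Its subsets are represented by the
   saturated subsets of R^2 (its open subsets by the open saturated ones), and
   curves in it by their lifts to R^2. *)
Definition torus_eq (L : R) (p q : R2) : Prop :=
  exists m n : Z,
    fst q = fst p + IZR m * L /\ snd q = snd p + IZR n * (2 * PI).

Definition saturated (L : R) (U : R2 -> Prop) : Prop :=
  forall p q, torus_eq L p q -> U p -> U q.

(* C^1 integral curves, on the open interval ]a, b[, of a field [D] of tangent
   lines: [D p v] means that the nonzero vector [v] spans the line at [p]. *)
Definition integral_curve (D : R2 -> R2 -> Prop) (a b : Rbar) (g : R -> R2)
    : Prop :=
  Rbar_lt a b /\
  forall t : R, Rbar_lt a t -> Rbar_lt t b ->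
    ex_derive (fun u => fst (g u)) t /\ ex_derive (fun u => snd (g u)) t /\
    continuous (Derive2 g) t /\ D (g t) (Derive2 g t).

Definition trace (L : R) (a b : Rbar) (g : R -> R2) (p : R2) : Prop :=
  exists t : R, Rbar_lt a t /\ Rbar_lt t b /\ torus_eq L (g t) p.

(* The parametrization of an integral curve of a line field is free, so a
   maximal integral curve is identified with its trace on the torus, and
   maximality is inclusion-maximality among traces of integral curves. *)
Definition maximal_integral_curve (L : R) (D : R2 -> R2 -> Prop)
    (l : R2 -> Prop) : Prop :=
  (exists a b g, integral_curve D a b g /\ l = trace L a b g) /\
  (forall a b g, integral_curve D a b g ->
     (forall p, l p -> trace L a b g p) -> forall p, trace L a b g p -> l p).

Definition principal_line (L : R) (c : R -> R3) (r theta : R -> R)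
    (F : foliation) (l : R2 -> Prop) : Prop :=
  maximal_integral_curve L (foliation_direction c r theta F) l.

Definition periodic_principal_line (L : R) (c : R -> R3) (r theta : R -> R)
    (F : foliation) (l : R2 -> Prop) : Prop :=
  principal_line L c r theta F l /\
  exists (g : R -> R2) (T : R), 0 < T /\
    integral_curve (foliation_direction c r theta F) m_infty p_infty g /\
    (forall t, torus_eq L (g t) (g (t + T))) /\
    l = trace L m_infty p_infty g.

Definition isolated_periodic_principal_line
    (L : R) (c : R -> R3) (r theta : R -> R)
    (F : foliation) (l : R2 -> Prop) : Prop :=
  periodic_principal_line L c r theta F l /\
  exists U : R2 -> Prop, open U /\ saturated L U /\
    (forall p, l p -> U p) /\
    forall l', periodic_principal_line L c r theta F l' ->
      (forall p, l' p -> U p) -> l' = l.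

(* Main.v *)
Require Import Defs.
From Stdlib Require Import Lra Lia Psatz Classical ClassicalEpsilon.
From Stdlib Require Import FunctionalExtensionality PropExtensionality Ranalysis5.
Open Scope R_scope.

(** Writing the differentials of the canal surface and of its normal in the
    Frenet frame ([differential_canal], [differential_inward_normal]) shows that
    the circles [s = const] are lines of curvature, with principal curvature
    [1 / r], and that the other lines of curvature are the graphs of the solutions
    of the equation
<<
      phi' = kappa cot(theta) sin(phi) - tau.
>>
    The inequality in the definition of an immersed canal surface makes the
    second principal curvature smaller than [1 / r], so the maximal foliation
    consists of the circles, which all are periodic and never isolated
    ([circles_not_isolated]), and the minimal one of the graphs of solutions
    ([foliation_direction_fields]).

    In the variable [tan (phi / 2)] the equation is a Riccati equation, so its
    Poincare map is a Moebius transformation of the circle: a power of it with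
    three fixed points is the identity. The proof uses the infinitesimal form of
    this fact. If [phi1] is a solution, then [phi] is another one exactly when
    [w = cot ((phi - phi1) / 2)] solves a linear equation, the same for all [phi].
    Three distinct closed minimal lines are graphs of solutions [phi1], [phi2],
    [phi3] of a common period modulo full turns; the two cotangents that they
    define are periodic, and so are all their affine combinations. Those which
    are everywhere large give closed solutions as close to [phi1] as one likes
    ([closed_solutions_near]), so the line of [phi1] is not isolated
    ([three_closed_lines_not_isolated]). *)

(** * Real analysis *)

Lemma continuous_mult_R (f g : R -> R) (x : R) :
  continuous f x -> continuous g x -> continuous (fun y => f y * g y) x.
Proof. exact (@continuous_mult R_UniformSpace R_AbsRing f g x). Qed.

Lemma continuous_plus_R (f g : R -> R) (x : R) :
  continuous f x -> continuous g x -> continuous (fun y => f y + g y) x.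
Proof. exact (@continuous_plus R_UniformSpace R_AbsRing R_NormedModule f g x). Qed.

Lemma continuous_minus_R (f g : R -> R) (x : R) :
  continuous f x -> continuous g x -> continuous (fun y => f y - g y) x.
Proof. exact (@continuous_minus R_UniformSpace R_AbsRing R_NormedModule f g x). Qed.

Lemma continuous_trig_comp (f : R -> R) (x : R) :
  continuous f x ->
  continuous (fun y => sin (f y)) x /\ continuous (fun y => cos (f y)) x.
Proof.
  intros Hf; split; apply continuous_comp; trivial; [apply continuous_sin | apply continuous_cos].
Qed.

(** [auto_derive] leaves the derivatives of unknown functions as [Derive] terms;
    this replaces the one whose value is given by the proof [H]. *)
Ltac derive_with H :=
  match type of H with
  | is_derive ?f ?x ?l => 
      replace (Derive (fun y => f y) x) with l by (symmetry; exact (is_derive_unique f x l H))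
  end.

Lemma continuous_of_is_derive (f : R -> R) (x l : R) :
  is_derive f x l -> continuous f x.
Proof. intros H; apply (@ex_derive_continuous R_AbsRing R_NormedModule); exists l; exact H. Qed.

Lemma continuous_bounded (f : R -> R) (a b : R) :
  a <= b -> (forall x, a <= x <= b -> continuous f x) ->
  exists M, forall x, a <= x <= b -> Rabs (f x) <= M.
Proof.
  intros Hab Hf.
  destruct (continuity_ab_maj (fun x => Rabs (f x)) a b Hab) as [m [Hm _]].
  - intros x Hx; apply continuity_pt_filterlim.
    apply (continuous_comp f Rabs); [now apply Hf | apply continuous_Rabs].
  - exists (Rabs (f m)); exact Hm.
Qed.

Lemma nonincreasing_of_derive (f df : R -> R) (a b : R) :
  a <= b -> (forall x, a <= x <= b -> is_derive f x (df x)) ->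
  (forall x, a <= x <= b -> df x <= 0) -> f b <= f a.
Proof.
  intros Hab Hd Hneg.
  destruct (MVT_gen f a b df) as [x [Hx E]].
  - rewrite Rmin_left, Rmax_right by lra; intros x Hx; apply Hd; lra.
  - rewrite Rmin_left, Rmax_right by lra; intros x Hx.
    apply continuity_pt_filterlim, (continuous_of_is_derive _ _ _ (Hd x Hx)).
  - rewrite Rmin_left, Rmax_right in Hx by lra.
    specialize (Hneg x Hx); nra.
Qed.

(** With [M] a bound of [K], the function [S^2 exp(-2 M t)] is nonincreasing and
    starts at zero. *)
Lemma linear_ode_zero_right (S K : R -> R) (t0 t1 : R) :
  t0 <= t1 ->
  (forall t, t0 <= t <= t1 -> is_derive S t (K t * S t) /\ continuous K t) ->
  S t0 = 0 -> S t1 = 0.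
Proof.
  intros Ht HS H0.
  destruct (continuous_bounded K t0 t1 Ht) as [M HM].
  { intros x Hx; apply HS, Hx. }
  assert (H : S t1 ^ 2 * exp (- 2 * M * t1) <= S t0 ^ 2 * exp (- 2 * M * t0)).
  { apply (nonincreasing_of_derive (fun t => S t ^ 2 * exp (- 2 * M * t))
             (fun t => 2 * S t ^ 2 * exp (- 2 * M * t) * (K t - M))); trivial.
    - intros t Ht'; destruct (HS t Ht') as [HSt _].
      auto_derive; [now exists (K t * S t)|].
      derive_with HSt; ring.
    - intros t Ht'.
      pose proof (exp_pos (- 2 * M * t)); pose proof (pow2_ge_0 (S t)).
      pose proof (Rle_trans _ _ _ (Rle_abs _) (HM t Ht')).
      assert (0 <= S t ^ 2 * exp (- 2 * M * t)) by (apply Rmult_le_pos; lra).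
      nra. }
  rewrite H0 in H.
  pose proof (exp_pos (- 2 * M * t1)); pose proof (pow2_ge_0 (S t1)).
  assert (S t1 ^ 2 = 0) by nra; nra.
Qed.

Lemma linear_ode_zero (S K : R -> R) (t0 t1 : R) :
  (forall t, Rmin t0 t1 <= t <= Rmax t0 t1 ->
     is_derive S t (K t * S t) /\ continuous K t) ->
  S t0 = 0 -> S t1 = 0.
Proof.
  intros HS H0.
  destruct (Rle_dec t0 t1) as [Hle | Hgt].
  - rewrite Rmin_left, Rmax_right in HS by trivial.
    now apply (linear_ode_zero_right S K t0 t1).
  - rewrite Rmin_right, Rmax_left in HS by lra.
    replace t1 with (- - t1) by ring.
    apply (linear_ode_zero_right (fun t => S (- t)) (fun t => - K (- t)) (- t0) (- t1)).
    + lra.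
    + intros t Ht; destruct (HS (- t)) as [HD HK]; [lra|]; split.
      * auto_derive; [now exists (K (- t) * S (- t))|].
        derive_with HD; ring.
      * apply (continuous_opp (V := R_NormedModule) (fun t => K (- t))).
        apply (continuous_comp Ropp K); [|exact HK].
        apply (continuous_opp (V := R_NormedModule) (fun t => t)), continuous_id.
    + now rewrite Ropp_involutive.
Qed.

(** * Angles modulo full turns *)

Definition cong (x y : R) : Prop := exists n : Z, x = y + IZR n * (2 * PI).

Lemma cong_refl x : cong x x.
Proof. exists 0%Z; ring. Qed.

Lemma cong_sym x y : cong x y -> cong y x.
Proof. intros [n ->]; exists (- n)%Z; rewrite opp_IZR; ring. Qed.

Lemma cong_trans x y z : cong x y -> cong y z -> cong x z.
Proof. intros [n ->] [m ->]; exists (n + m)%Z; rewrite plus_IZR; ring. Qed.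

(** The sine turns congruence of angles into the vanishing of a real function,
    which is what a linear differential equation can propagate. *)
Lemma cong_sin_half x y : cong x y <-> sin ((x - y) / 2) = 0.
Proof.
  split.
  - intros [n ->]; apply sin_eq_0_1; exists n; field.
  - intros H; destruct (sin_eq_0_0 _ H) as [n E]; exists n; lra.
Qed.

(** Stated for an arbitrary equivalence [E], so that it applies both to equality
    and to congruence of angles. *)
Lemma periodic_Z {A : Type} (E : A -> A -> Prop) (f : R -> A) (P : R) :
  (forall x, E x x) -> (forall x y, E x y -> E y x) ->
  (forall x y z, E x y -> E y z -> E x z) ->
  (forall x, E (f (x + P)) (f x)) ->
  forall (k : Z) x, E (f (x + IZR k * P)) (f x).
Proof.
  intros Er Es Et H k.
  assert (Hn : forall (n : nat) x, E (f (x + INR n * P)) (f x)).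
  { induction n as [|n IH]; intros x.
    - simpl; rewrite Rmult_0_l, Rplus_0_r; apply Er.
    - rewrite S_INR; replace (x + (INR n + 1) * P) with ((x + INR n * P) + P) by ring.
      eapply Et; [apply H | apply IH]. }
  intros x; destruct (Z_le_dec 0 k) as [Hk | Hk].
  - rewrite <- (Z2Nat.id k Hk), <- INR_IZR_INZ; apply Hn.
  - apply Es.
    replace (f x) with (f ((x + IZR k * P) + INR (Z.to_nat (- k)) * P)); [apply Hn|].
    f_equal; rewrite INR_IZR_INZ, Z2Nat.id, opp_IZR by lia; ring.
Qed.

Lemma cong_periodic_Z (f : R -> R) (P : R) :
  (forall x, cong (f (x + P)) (f x)) -> forall k x, cong (f (x + IZR k * P)) (f x).
Proof. apply periodic_Z; [apply cong_refl | apply cong_sym | apply cong_trans]. Qed.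

(** * Periodic functions and neighborhoods of arcs *)

Lemma reduce_to_period (P s : R) : 0 < P -> exists k : Z, 0 <= s + IZR k * P <= P.
Proof.
  intros HP; exists (1 - up (s / P))%Z.
  destruct (archimed (s / P)) as [H1 H2].
  rewrite minus_IZR.
  assert (E : s = s / P * P) by (field; lra).
  set (u := IZR (up (s / P))) in *; set (q := s / P) in *.
  rewrite E; split; nra.
Qed.

Lemma periodic_bounded (f : R -> R) (P : R) :
  0 < P -> periodic P f -> (forall x, continuous f x) ->
  exists M, forall x, Rabs (f x) <= M.
Proof.
  intros HP Hper Hf.
  destruct (continuous_bounded f 0 P) as [M HM]; [lra | now intros; apply Hf |].
  exists M; intros x; destruct (reduce_to_period P x HP) as [k Hk].
  rewrite <- (periodic_Z eq f P (@eq_refl R) (@eq_sym R) (@eq_trans R) Hper k x).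
  now apply HM.
Qed.

Lemma nonvanishing_same_sign (f : R -> R) (x y : R) :
  (forall t, continuous f t) -> (forall t, f t <> 0) -> 0 < f x -> 0 < f y.
Proof.
  intros Hf Hn Hx; destruct (Rlt_dec 0 (f y)) as [H | H]; trivial; exfalso.
  destruct (IVT_gen f x y 0) as [t [_ Ht]].
  - intros t; apply continuity_pt_filterlim, Hf.
  - rewrite Rmin_right, Rmax_left; lra.
  - exact (Hn t Ht).
Qed.

(** Compactness of [[a, b]]: the sizes of the balls contained in [U] around the
    points of the curve have a uniform positive lower bound. *)
Lemma open_contains_tube (U : R2 -> Prop) (g : R -> R2) (a b : R) :
  open U ->
  (forall t, continuous (fun u => fst (g u)) t /\ continuous (fun u => snd (g u)) t) ->
  (forall t, a <= t <= b -> U (g t)) ->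
  exists d, 0 < d /\ forall t q, a <= t <= b ->
    Rabs (fst q - fst (g t)) < d -> Rabs (snd q - snd (g t)) < d -> U q.
Proof.
  intros HU Hg HgU.
  assert (H : forall t, exists d : posreal, a <= t <= b ->
    forall t' q, Rabs (t' - t) < d ->
      Rabs (fst q - fst (g t')) < d -> Rabs (snd q - snd (g t')) < d -> U q).
  { intros t; destruct (classic (a <= t <= b)) as [Ht | Ht].
    2: { exists (mkposreal 1 Rlt_0_1); tauto. }
    destruct (HU _ (HgU t Ht)) as [e He].
    assert (He2 : 0 < e / 2) by (destruct e; simpl; lra).
    destruct (Hg t) as [H1 H2].
    destruct (proj1 (filterlim_locally _ _) H1 (mkposreal _ He2)) as [d1 Hd1].
    destruct (proj1 (filterlim_locally _ _) H2 (mkposreal _ He2)) as [d2 Hd2].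
    assert (Hd : 0 < Rmin (e / 2) (Rmin d1 d2)).
    { destruct d1, d2; simpl; repeat apply Rmin_pos; trivial. }
    exists (mkposreal _ Hd); intros _ t' q Htt Hq1 Hq2; simpl in *.
    assert (Rmin (e / 2) (Rmin d1 d2) <= e / 2) by apply Rmin_l.
    assert (Rmin (e / 2) (Rmin d1 d2) <= d1)
      by (eapply Rle_trans; [apply Rmin_r | apply Rmin_l]).
    assert (Rmin (e / 2) (Rmin d1 d2) <= d2)
      by (eapply Rle_trans; [apply Rmin_r | apply Rmin_r]).
    apply He; split.
    - specialize (Hd1 t' (Rlt_le_trans _ _ _ Htt H0)).
      unfold ball in *; simpl in *; unfold AbsRing_ball, abs, minus, plus, opp in *; simpl in *.
      revert Hd1 Hq1; unfold Rabs; repeat destruct Rcase_abs; lra.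
    - specialize (Hd2 t' (Rlt_le_trans _ _ _ Htt H3)).
      unfold ball in *; simpl in *; unfold AbsRing_ball, abs, minus, plus, opp in *; simpl in *.
      revert Hd2 Hq2; unfold Rabs; repeat destruct Rcase_abs; lra. }
  pose (delta := fun t => proj1_sig (constructive_indefinite_description _ (H t))).
  assert (Hdelta : forall t, a <= t <= b -> forall t' q, Rabs (t' - t) < delta t ->
      Rabs (fst q - fst (g t')) < delta t -> Rabs (snd q - snd (g t')) < delta t -> U q).
  { intros t; unfold delta; destruct constructive_indefinite_description; trivial. }
  destruct (compactness_value_1d a b delta) as [d Hd].
  exists d; split; [apply cond_pos|].
  intros t q Ht Hq1 Hq2.
  destruct (NNPP _ (Hd t Ht)) as [t' [Ht' [Htt Hle]]].
  apply (Hdelta t' Ht' t q); lra.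
Qed.

(** * The slope equation of the minimal lines *)

Definition solution (a tau phi : R -> R) : Prop :=
  forall s, is_derive phi s (a s * sin (phi s) - tau s).

Definition slope_field (a tau : R -> R) (p v : R2) : Prop :=
  fst v <> 0 /\ snd v = fst v * (a (fst p) * sin (snd p) - tau (fst p)).

Definition graph_line (L : R) (phi : R -> R) : R2 -> Prop :=
  trace L m_infty p_infty (fun s => (s, phi s)).

Lemma continuous_solution a tau phi :
  solution a tau phi -> forall s, continuous phi s.
Proof. intros H s; exact (continuous_of_is_derive _ _ _ (H s)). Qed.

Lemma periodic_Z_eq (f : R -> R) (L : R) :
  periodic L f -> forall k x, f (x + IZR k * L) = f x.
Proof. exact (periodic_Z eq f L (@eq_refl R) (@eq_sym R) (@eq_trans R)). Qed.

Lemma solution_shift L a tau phi (m : Z) :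
  periodic L a -> periodic L tau -> solution a tau phi ->
  solution a tau (fun s => phi (s + IZR m * L)).
Proof.
  intros Ha Htau Hphi s.
  pose proof (Hphi (s + IZR m * L)) as H.
  rewrite (periodic_Z_eq a L Ha), (periodic_Z_eq tau L Htau) in H.
  auto_derive; [eexists; exact H|].
  derive_with H; ring.
Qed.

Lemma torus_eq_refl L p : torus_eq L p p.
Proof. exists 0%Z, 0%Z; split; ring. Qed.

Lemma torus_eq_sym L p q : torus_eq L p q -> torus_eq L q p.
Proof.
  intros [m [n [E1 E2]]]; exists (- m)%Z, (- n)%Z.
  rewrite E1, E2, !opp_IZR; split; ring.
Qed.

Lemma torus_eq_trans L p q x : torus_eq L p q -> torus_eq L q x -> torus_eq L p x.
Proof.
  intros [m [n [E1 E2]]] [m' [n' [E1' E2']]]; exists (m + m')%Z, (n + n')%Z.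
  rewrite E1', E2', E1, E2, !plus_IZR; split; ring.
Qed.

Lemma Rbar_between (A B : Rbar) (t0 t1 t : R) :
  Rbar_lt A t0 -> Rbar_lt t0 B -> Rbar_lt A t1 -> Rbar_lt t1 B ->
  Rmin t0 t1 <= t <= Rmax t0 t1 -> Rbar_lt A t /\ Rbar_lt t B.
Proof.
  unfold Rmin, Rmax; destruct A, B; simpl; try tauto;
    destruct (Rle_dec t0 t1); intros; split; trivial; lra.
Qed.

Lemma continuous_fst_comp (h : R -> R2) (t : R) :
  continuous h t -> continuous (fun u => fst (h u)) t.
Proof.
  intros Hh; apply (continuous_comp h fst t Hh).
  destruct (h t); apply continuous_fst.
Qed.

(** Uniqueness of solutions, for an arbitrarily parametrized curve. Along the curve
    put [S = sin ((y - phi x) / 2)]. The difference of the two slopes is a multiple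
    of [sin y - sin (phi x)], hence of [S], so [S] solves a homogeneous linear
    equation and vanishes identically once it vanishes at one point. *)
Lemma integral_curve_stays_on_graph (a tau phi : R -> R) A B g (t0 t1 : R) :
  (forall s, continuous a s) -> solution a tau phi ->
  integral_curve (slope_field a tau) A B g ->
  Rbar_lt A t0 -> Rbar_lt t0 B -> Rbar_lt A t1 -> Rbar_lt t1 B ->
  cong (snd (g t0)) (phi (fst (g t0))) -> cong (snd (g t1)) (phi (fst (g t1))).
Proof.
  intros Ha Hphi [_ Hg] HA0 HB0 HA1 HB1.
  rewrite !cong_sin_half.
  set (x := fun t => fst (g t)); set (y := fun t => snd (g t)).
  apply (linear_ode_zero (fun t => sin ((y t - phi (x t)) / 2))
    (fun t => a (x t) * Derive x t * ((cos (y t) + cos (phi (x t))) / 2))).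
  intros t Ht.
  destruct (Rbar_between A B t0 t1 t HA0 HB0 HA1 HB1 Ht) as [HA HB].
  destruct (Hg t HA HB) as [Hx [Hy [HD [_ Hslope]]]]; clear Hg Ht.
  change (ex_derive x t) in Hx; change (ex_derive y t) in Hy.
  change (Derive y t = Derive x t * (a (x t) * sin (y t) - tau (x t))) in Hslope.
  pose proof (Hphi (x t)) as Hp.
  split.
  - auto_derive.
    + repeat split; trivial; eexists; exact Hp.
    + derive_with Hp.
      change (Derive (fun u => y u) t) with (Derive y t).
      change (Derive (fun u => x u) t) with (Derive x t).
      rewrite Hslope, form1.
      pose proof (form4 (y t) (phi (x t))) as Hs.
      transitivity (cos ((y t - phi (x t)) / 2) * (Derive x t * a (x t) / 2)
                    * (sin (y t) - sin (phi (x t)))); [unfold Rdiv, Rminus; field|].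
      rewrite Hs; field.
  - assert (Hcx : continuous x t)
      by exact (@ex_derive_continuous R_AbsRing R_NormedModule x t Hx).
    assert (Hcy : continuous y t)
      by exact (@ex_derive_continuous R_AbsRing R_NormedModule y t Hy).
    apply continuous_mult_R; [apply continuous_mult_R|].
    + now apply continuous_comp.
    + exact (continuous_fst_comp (Derive2 g) t HD).
    + apply continuous_mult_R; [|apply continuous_const].
      apply continuous_plus_R; apply continuous_trig_comp; trivial.
      apply continuous_comp; trivial; apply (continuous_solution _ _ _ Hphi).
Qed.

Lemma graph_integral_curve (a tau phi : R -> R) :
  (forall s, continuous a s) -> (forall s, continuous tau s) -> solution a tau phi ->
  integral_curve (slope_field a tau) m_infty p_infty (fun s => (s, phi s)).
Proof.
  intros Ha Htau Hphi; split; [exact I|]; intros t _ _; simpl.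
  assert (HD : Derive2 (fun s => (s, phi s)) = fun s => (1, a s * sin (phi s) - tau s)).
  { apply functional_extensionality; intros s; unfold Derive2; simpl.
    rewrite Derive_id; f_equal; apply is_derive_unique, Hphi. }
  repeat split.
  - apply (ex_derive_id (K := R_AbsRing)).
  - eexists; apply Hphi.
  - rewrite HD.
    apply (continuous_comp_2 (fun _ : R => 1) (fun s => a s * sin (phi s) - tau s)
             (fun u v : R => (u, v))).
    + apply continuous_const.
    + apply continuous_minus_R; trivial; apply continuous_mult_R; trivial.
      apply continuous_trig_comp, (continuous_solution _ _ _ Hphi).
    + apply continuous_ext with (fun z : R * R => z); [now intros []|].
      apply continuous_id.
  - rewrite HD; simpl; lra.
  - rewrite HD; simpl; ring.
Qed.

Lemma solutions_cong (a tau phi psi : R -> R) (s0 s : R) :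
  (forall s, continuous a s) -> (forall s, continuous tau s) ->
  solution a tau phi -> solution a tau psi ->
  cong (phi s0) (psi s0) -> cong (phi s) (psi s).
Proof.
  intros Ha Htau Hphi Hpsi.
  exact (integral_curve_stays_on_graph a tau psi m_infty p_infty (fun s => (s, phi s)) s0 s
    Ha Hpsi (graph_integral_curve a tau phi Ha Htau Hphi) I I I I).
Qed.

Lemma graph_line_eq L phi psi :
  (forall s, cong (phi s) (psi s)) -> graph_line L phi = graph_line L psi.
Proof.
  intros H.
  assert (Hsub : forall f h p, (forall s, cong (f s) (h s)) -> graph_line L f p -> graph_line L h p).
  { intros f h p Hc [s [_ [_ Hs]]]; exists s; repeat split.
    apply torus_eq_trans with (s, f s); trivial.
    destruct (Hc s) as [n Hn]; exists 0%Z, n; simpl; split; [ring | exact Hn]. }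
  apply functional_extensionality; intros p; apply propositional_extensionality; split;
    apply Hsub; trivial; intros s; now apply cong_sym.
Qed.

(** * Closed integral curves are graphs *)

(** An integral curve through one point of the graph agrees there, up to a
    translation by periods, with a shifted solution, and uniqueness keeps it on
    the graph. *)
Lemma graph_line_maximal L (a tau phi : R -> R) :
  (forall s, continuous a s) -> (forall s, continuous tau s) ->
  periodic L a -> periodic L tau -> solution a tau phi ->
  maximal_integral_curve L (slope_field a tau) (graph_line L phi).
Proof.
  intros Ha Htau HLa HLtau Hphi; split.
  - exists m_infty, p_infty, (fun s => (s, phi s)); split; [|reflexivity].
    now apply graph_integral_curve.
  - intros A B g Hg Hsub p [t [HA [HB Ht]]].
    destruct (Hsub (0, phi 0)) as [t0 [HA0 [HB0 [m [n [E1 E2]]]]]].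
    { exists 0; repeat split; apply torus_eq_refl. }
    simpl in E1, E2.
    pose proof (integral_curve_stays_on_graph a tau (fun s => phi (s + IZR m * L)) A B g t0 t
      Ha (solution_shift L a tau phi m HLa HLtau Hphi) Hg HA0 HB0 HA HB) as H.
    destruct H as [k Hk].
    { simpl; rewrite <- E1, E2; exists (- n)%Z; rewrite opp_IZR; ring. }
    exists (fst (g t) + IZR m * L); repeat split.
    apply torus_eq_trans with (g t); trivial.
    exists (- m)%Z, k; simpl; rewrite opp_IZR; split; [ring | exact Hk].
Qed.

Lemma increasing_of_derive (f : R -> R) :
  (forall t, ex_derive f t) -> (forall t, 0 < Derive f t) ->
  forall x y, x < y -> f x < f y.
Proof.
  intros Hex Hpos x y Hxy.
  destruct (MVT_gen f x y (Derive f)) as [z [_ E]].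
  - intros; now apply Derive_correct.
  - intros z _; apply continuity_pt_filterlim.
    exact (@ex_derive_continuous R_AbsRing R_NormedModule f z (Hex z)).
  - specialize (Hpos z); nra.
Qed.

Lemma inverse_is_derive (f h : R -> R) (s : R) :
  (forall t, ex_derive f t) -> (forall t, 0 < Derive f t) -> (forall u, f (h u) = u) ->
  is_derive h s (/ Derive f (h s)).
Proof.
  intros Hex Hpos Hinv.
  pose proof (increasing_of_derive f Hex Hpos) as Hincr.
  assert (Hmono : forall x y, x <= y -> h x <= h y).
  { intros x y Hxy; destruct (Rle_dec (h x) (h y)) as [|Hn]; trivial.
    assert (f (h y) < f (h x)) by (apply Hincr; lra).
    rewrite !Hinv in H; lra. }
  assert (Hcont : continuity_pt h s).
  { apply continuity_pt_filterlim, filterlim_locally; intros [e He].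
    assert (Hl : f (h s - e) < s) by (rewrite <- (Hinv s) at 2; apply Hincr; lra).
    assert (Hr : s < f (h s + e)) by (rewrite <- (Hinv s) at 1; apply Hincr; lra).
    assert (Hd : 0 < Rmin (s - f (h s - e)) (f (h s + e) - s)) by (apply Rmin_pos; lra).
    exists (mkposreal _ Hd); intros u Hu.
    pose proof (Rmin_l (s - f (h s - e)) (f (h s + e) - s)).
    pose proof (Rmin_r (s - f (h s - e)) (f (h s + e) - s)).
    unfold ball in *; simpl in *; unfold AbsRing_ball, abs, minus, plus, opp in *; simpl in *.
    apply Rabs_def2 in Hu.
    assert (H1 : h s - e < h u).
    { destruct (Rlt_dec (h s - e) (h u)) as [|Hn]; trivial; exfalso.
      destruct (Rle_lt_or_eq_dec (h u) (h s - e)) as [Hlt | Heq]; [lra | |].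
      - apply Hincr in Hlt; rewrite Hinv in Hlt; lra.
      - rewrite <- Heq, Hinv in *; lra. }
    assert (H2 : h u < h s + e).
    { destruct (Rlt_dec (h u) (h s + e)) as [|Hn]; trivial; exfalso.
      destruct (Rle_lt_or_eq_dec (h s + e) (h u)) as [Hlt | Heq]; [lra | |].
      - apply Hincr in Hlt; rewrite Hinv in Hlt; lra.
      - rewrite Heq, Hinv in *; lra. }
    apply Rabs_def1; lra. }
  assert (Hder : forall x, derivable_pt f x).
  { intros x; exists (Derive f x); apply is_derive_Reals, Derive_correct, Hex. }
  assert (Hval : forall x pr, derive_pt f x pr = Derive f x).
  { intros x pr; apply Derive_Reals. }
  assert (Henc : h (s - 1) <= h s <= h (s + 1)) by (split; apply Hmono; lra).
  assert (Hin : s - 1 < s < s + 1) by lra.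
  pose proof (derivable_pt_lim_recip_interv f h (s - 1) (s + 1) s
    (fun x _ => Hder x) Hcont ltac:(lra) Hin Henc (fun x _ => Hinv x)) as H.
  rewrite Hval in H; apply is_derive_Reals.
  replace (/ Derive f (h s)) with (1 / Derive f (h s)).
  - apply H; specialize (Hpos (h s)); lra.
  - unfold Rdiv; ring.
Qed.

(** The first coordinate of the curve increases from minus to plus infinity, so
    the curve can be parametrized by it. The point where the curve closes up gives a
    period of the resulting solution at one point, and uniqueness gives it
    everywhere. *)
Lemma closed_curve_is_graph_increasing L (a tau : R -> R) (g : R -> R2) (T : R) :
  (forall s, continuous a s) -> (forall s, continuous tau s) ->
  periodic L a -> periodic L tau -> 0 < L -> 0 < T ->
  integral_curve (slope_field a tau) m_infty p_infty g ->
  (forall t, 0 < Derive (fun u => fst (g u)) t) ->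
  (forall t, torus_eq L (g t) (g (t + T))) ->
  exists phi (Q : nat), solution a tau phi /\ (0 < Q)%nat /\
    (forall s, cong (phi (s + INR Q * L)) (phi s)) /\
    trace L m_infty p_infty g = graph_line L phi.
Proof.
  intros Ha Htau HLa HLtau HL HT [_ Hg] Hpos Hclosed.
  set (x := fun t => fst (g t)) in *; set (y := fun t => snd (g t)).
  assert (Hx : forall t, ex_derive x t) by (intros t; apply (Hg t I I)).
  assert (Hy : forall t, ex_derive y t) by (intros t; apply (Hg t I I)).
  assert (Hslope : forall t, Derive y t = Derive x t * (a (x t) * sin (y t) - tau (x t))).
  { intros t; apply (Hg t I I). }
  clear Hg.
  pose proof (increasing_of_derive x Hx Hpos) as Hincr.
  (* Each turn of the closed curve advances the first coordinate by at least one
     full period, so this coordinate takes every value. *)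
  assert (Hturn : forall t, x t + L <= x (t + T)).
  { intros t; destruct (Hclosed t) as [m [n [E _]]].
    change (x (t + T) = x t + IZR m * L) in E.
    pose proof (Hincr t (t + T) ltac:(lra)).
    assert (0 < IZR m) by nra.
    assert (1 <= IZR m) by (apply (IZR_le 1), Z.lt_pred_le, lt_IZR; simpl; lra).
    nra. }
  assert (Hup : forall n : nat, x 0 + INR n * L <= x (INR n * T)).
  { induction n as [|n IH]; [simpl; rewrite !Rmult_0_l; lra|].
    rewrite S_INR; replace ((INR n + 1) * T) with (INR n * T + T) by ring.
    specialize (Hturn (INR n * T)); lra. }
  assert (Hdown : forall n : nat, x (- (INR n * T)) <= x 0 - INR n * L).
  { induction n as [|n IH]; [simpl; rewrite !Rmult_0_l, Ropp_0; lra|].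
    rewrite S_INR; specialize (Hturn (- ((INR n + 1) * T))).
    replace (- ((INR n + 1) * T) + T) with (- (INR n * T)) in Hturn by ring; lra. }
  assert (Honto : forall s, exists t, x t = s).
  { intros s.
    destruct (INR_archimed L (Rabs (s - x 0)) HL) as [n Hn].
    specialize (Hup n); specialize (Hdown n).
    destruct (IVT_gen x (- (INR n * T)) (INR n * T) s) as [t [_ Ht]].
    - intros t; apply continuity_pt_filterlim.
      exact (@ex_derive_continuous R_AbsRing R_NormedModule x t (Hx t)).
    - assert (Hn2 : - (INR n * L) < s - x 0 < INR n * L) by (split; revert Hn; unfold Rabs; destruct Rcase_abs; lra).
      rewrite Rmin_left, Rmax_right; lra.
    - now exists t. }
  pose (h := fun s => proj1_sig (constructive_indefinite_description _ (Honto s))).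
  assert (Hinv : forall s, x (h s) = s).
  { intros s; unfold h; now destruct constructive_indefinite_description. }
  assert (Hinv' : forall t, h (x t) = t).
  { intros t; destruct (Rtotal_order (h (x t)) t) as [H | [H | H]]; trivial;
      apply Hincr in H; rewrite Hinv in H; lra. }
  assert (Hsol : solution a tau (fun s => y (h s))).
  { intros s.
    pose proof (inverse_is_derive x h s Hx Hpos Hinv) as Hh.
    pose proof (Derive_correct _ _ (Hy (h s))) as Hyh.
    pose proof (is_derive_comp y h s _ _ Hyh Hh) as H.
    replace (a s * sin (y (h s)) - tau s) with (scal (/ Derive x (h s)) (Derive y (h s))); trivial.
    rewrite Hslope, Hinv; unfold scal; simpl; unfold mult; simpl.
    specialize (Hpos (h s)); field; lra. }
  destruct (Hclosed 0) as [m [n [E1 E2]]].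
  change (x (0 + T) = x 0 + IZR m * L) in E1.
  change (y (0 + T) = y 0 + IZR n * (2 * PI)) in E2.
  assert (Hm : (0 < m)%Z).
  { pose proof (Hincr 0 (0 + T) ltac:(lra)); apply lt_IZR; simpl; nra. }
  exists (fun s => y (h s)), (Z.to_nat m); split; [exact Hsol | split; [lia | split]].
  - intros s.
    replace (INR (Z.to_nat m)) with (IZR m) by (rewrite INR_IZR_INZ, Z2Nat.id; trivial; lia).
    apply (solutions_cong a tau (fun s => y (h (s + IZR m * L))) (fun s => y (h s)) (x 0) s); trivial.
    + now apply (solution_shift L a tau (fun s => y (h s))).
    + simpl; rewrite <- E1, !Hinv'; exists n; exact E2.
  - apply functional_extensionality; intros p; apply propositional_extensionality; split.
    + intros [t [_ [_ Ht]]]; exists (x t); repeat split; rewrite Hinv'.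
      unfold x, y; now rewrite <- surjective_pairing.
    + intros [s [_ [_ Hs]]]; exists (h s); repeat split.
      rewrite (surjective_pairing (g (h s))); change (fst (g (h s))) with (x (h s)).
      rewrite Hinv; exact Hs.
Qed.

Lemma is_derive_reflect (f : R -> R) (t l : R) :
  is_derive f (- t) l -> is_derive (fun u => f (- u)) t (- l).
Proof. intros H; auto_derive; [now exists l|]; derive_with H; ring. Qed.

Lemma closed_curve_is_graph L (a tau : R -> R) (g : R -> R2) (T : R) :
  (forall s, continuous a s) -> (forall s, continuous tau s) ->
  periodic L a -> periodic L tau -> 0 < L -> 0 < T ->
  integral_curve (slope_field a tau) m_infty p_infty g ->
  (forall t, torus_eq L (g t) (g (t + T))) ->
  exists phi (Q : nat), solution a tau phi /\ (0 < Q)%nat /\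
    (forall s, cong (phi (s + INR Q * L)) (phi s)) /\
    trace L m_infty p_infty g = graph_line L phi.
Proof.
  intros Ha Htau HLa HLtau HL HT Hg Hclosed.
  assert (Hcont : forall t, continuous (Derive (fun u => fst (g u))) t).
  { intros t; apply (continuous_fst_comp (Derive2 g)), (proj2 Hg t I I). }
  assert (Hne : forall t, Derive (fun u => fst (g u)) t <> 0).
  { intros t; apply (proj2 Hg t I I). }
  destruct (Rlt_dec 0 (Derive (fun u => fst (g u)) 0)) as [Hpos | Hneg].
  - apply (closed_curve_is_graph_increasing L a tau g T); trivial.
    intros t; now apply (nonvanishing_same_sign _ 0 t Hcont Hne).
  - assert (Hneg' : forall t, Derive (fun u => fst (g u)) t < 0).
    { intros t; destruct (Rlt_dec (Derive (fun u => fst (g u)) t) 0) as [|H]; trivial.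
      exfalso; apply Hneg, (nonvanishing_same_sign _ t 0 Hcont Hne).
      specialize (Hne t); lra. }
    assert (HD : Derive2 (fun t => g (- t)) =
      fun t => (- fst (Derive2 g (- t)), - snd (Derive2 g (- t)))).
    { apply functional_extensionality; intros t; unfold Derive2; simpl.
      destruct (proj2 Hg (- t) I I) as [Hx [Hy _]]; f_equal; apply is_derive_unique.
      - exact (is_derive_reflect (fun u => fst (g u)) t _ (Derive_correct _ _ Hx)).
      - exact (is_derive_reflect (fun u => snd (g u)) t _ (Derive_correct _ _ Hy)). }
    destruct (closed_curve_is_graph_increasing L a tau (fun t => g (- t)) T)
      as [phi [Q [H1 [H2 [H3 H4]]]]]; trivial.
    + split; [exact I|]; intros t _ _.
      destruct (proj2 Hg (- t) I I) as [Hx [Hy [HDc [Hv1 Hv2]]]].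
      repeat split.
      * eexists; apply (is_derive_reflect (fun u => fst (g u))), Derive_correct, Hx.
      * eexists; apply (is_derive_reflect (fun u => snd (g u))), Derive_correct, Hy.
      * rewrite HD.
        apply (continuous_comp (fun t : R => - t) (fun t => (- fst (Derive2 g t), - snd (Derive2 g t)))).
        -- apply (continuous_opp (V := R_NormedModule) (fun t => t)), continuous_id.
        -- exact (continuous_opp (V := prod_NormedModule R_AbsRing R_NormedModule R_NormedModule) (Derive2 g) (- t) HDc).
      * rewrite HD; exact (Ropp_neq_0_compat _ Hv1).
      * rewrite HD.
        change (- snd (Derive2 g (- t)) = - fst (Derive2 g (- t)) *
          (a (fst (g (- t))) * sin (snd (g (- t))) - tau (fst (g (- t))))).
        rewrite Hv2; ring.
    + intros t; change (0 < fst (Derive2 (fun t => g (- t)) t)); rewrite HD; simpl.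
      specialize (Hneg' (- t)); lra.
    + intros t; apply torus_eq_sym.
      replace (g (- t)) with (g (- (t + T) + T)) by (f_equal; ring); apply Hclosed.
    + exists phi, Q; split; [exact H1 | split; [exact H2 | split; [exact H3 |]]]; rewrite <- H4.
      apply functional_extensionality; intros p; apply propositional_extensionality; split;
        intros [t [_ [_ Ht]]]; exists (- t); repeat split; rewrite ?Ropp_involutive; trivial.
Qed.

(** * Solutions generated by three closed ones *)

(** The cotangent of [(psi - phi) / 2], that is, the coordinate on the circle of
    directions which sends the known solution [phi] to infinity. *)
Definition half_cot (phi psi : R -> R) (s : R) : R :=
  cos ((psi s - phi s) / 2) / sin ((psi s - phi s) / 2).

(** In this coordinate the Riccati equation becomes linear, because the point at
    infinity is itself a solution. *)
Lemma half_cot_is_derive (a tau phi psi : R -> R) (s : R) :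
  solution a tau phi -> solution a tau psi -> ~ cong (psi s) (phi s) ->
  is_derive (half_cot phi psi) s (a s * (sin (phi s) - cos (phi s) * half_cot phi psi s)).
Proof.
  intros Hphi Hpsi Hne; rewrite cong_sin_half in Hne.
  pose proof (Hphi s) as H1; pose proof (Hpsi s) as H2.
  unfold half_cot; auto_derive.
  - repeat split; trivial; eexists; [exact H2 | exact H1 | exact H2 | exact H1].
  - derive_with H1; derive_with H2.
    change ((psi s + - phi s) * / 2) with ((psi s - phi s) / 2).
    set (u := (psi s - phi s) / 2) in *.
    assert (E : a s * sin (psi s) - a s * sin (phi s)
              = 2 * a s * sin u * (cos (phi s) * cos u - sin (phi s) * sin u)).
    { replace (psi s) with (phi s + 2 * u) by (unfold u; field).
      rewrite sin_plus, sin_2a, cos_2a_sin; ring. }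
    pose proof (sin2_cos2 u) as Hp; unfold Rsqr in Hp.
    transitivity (- ((a s * sin (psi s) - a s * sin (phi s)) / 2)
                  * (sin u * sin u + cos u * cos u) / (sin u * sin u)).
    + field; trivial.
    + rewrite Hp, E; field; trivial.
Qed.

Lemma half_cot_cong (phi psi : R -> R) (s t : R) :
  ~ cong (psi s) (phi s) -> cong (phi t) (phi s) -> cong (psi t) (psi s) ->
  half_cot phi psi t = half_cot phi psi s.
Proof.
  intros Hne Hphi Hpsi.
  assert (Hne' : ~ cong (psi t) (phi t)).
  { intros H; apply Hne.
    apply cong_trans with (psi t); [now apply cong_sym|].
    now apply cong_trans with (phi t). }
  rewrite cong_sin_half in Hne, Hne'; unfold half_cot.
  destruct Hphi as [n Hn]; destruct Hpsi as [m Hm].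
  assert (H : sin ((psi t - phi t) / 2 - (psi s - phi s) / 2) = 0).
  { apply sin_eq_0_1; exists (m - n)%Z; rewrite minus_IZR, Hn, Hm; field. }
  rewrite sin_minus in H.
  apply Rmult_eq_reg_r with (sin ((psi t - phi t) / 2) * sin ((psi s - phi s) / 2));
    [field_simplify; trivial; lra | now apply Rmult_integral_contrapositive].
Qed.

(** The difference is [sin ((chi - psi) / 2)] divided by the product of the two
    sines. *)
Lemma half_cot_ne (phi psi chi : R -> R) (s : R) :
  ~ cong (psi s) (phi s) -> ~ cong (chi s) (phi s) -> ~ cong (psi s) (chi s) ->
  half_cot phi psi s - half_cot phi chi s <> 0.
Proof.
  rewrite !cong_sin_half; unfold half_cot; intros H1 H2 H3 H; apply H3.
  replace ((psi s - chi s) / 2) with ((psi s - phi s) / 2 - (chi s - phi s) / 2) by field.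
  rewrite sin_minus.
  apply (f_equal (Rmult (sin ((psi s - phi s) / 2) * sin ((chi s - phi s) / 2)))) in H.
  field_simplify in H; trivial; lra.
Qed.

(** Converse of [half_cot_is_derive]: any positive solution of the linear equation is
    the half cotangent of a solution of the slope equation. Positivity selects one
    smooth branch of the inverse cotangent, [atan (/ w)]. *)
Lemma solution_of_half_cot (a tau phi w : R -> R) :
  solution a tau phi -> (forall s, 0 < w s) ->
  (forall s, is_derive w s (a s * (sin (phi s) - cos (phi s) * w s))) ->
  solution a tau (fun s => phi s + 2 * atan (/ w s)).
Proof.
  intros Hphi Hpos Hw s.
  pose proof (Hphi s) as H1; pose proof (Hw s) as H2; specialize (Hpos s).
  auto_derive.
  - repeat split; [eexists; exact H1 | eexists; exact H2 | lra].
  - derive_with H1; derive_with H2.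
    assert (Hs : sin (phi s + 2 * atan (/ w s)) =
      (sin (phi s) * (w s * w s - 1) + 2 * cos (phi s) * w s) / (w s * w s + 1)).
    { rewrite sin_plus, sin_2a, cos_2a, sin_atan, cos_atan.
      assert (Hq : 0 < 1 + (/ w s)²) by (pose proof (Rle_0_sqr (/ w s)); lra).
      pose proof (sqrt_lt_R0 _ Hq) as Hr.
      pose proof (sqrt_sqrt _ (Rlt_le _ _ Hq)) as Hrr.
      set (q := sqrt (1 + (/ w s)²)) in *.
      transitivity ((sin (phi s) * (1 - / w s * / w s) + cos (phi s) * 2 * / w s) / (q * q)).
      - field; lra.
      - rewrite Hrr; unfold Rsqr; field; split; nra. }
    rewrite Hs; unfold Rsqr; field; split; [nra | lra].
Qed.

Lemma atan_le_id (x : R) : 0 <= x -> atan x <= x.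
Proof.
  intros Hx.
  pose proof (nonincreasing_of_derive (fun y => atan y - y) (fun y => / (1 + y * y) - 1) 0 x Hx) as H.
  cbv beta in H; rewrite atan_0 in H.
  enough (atan x - x <= 0 - 0) by lra; apply H.
  - intros y _; auto_derive; trivial; unfold Rsqr; field; nra.
  - intros y _.
    assert (/ (1 + y * y) <= / 1) by (apply Rinv_le_contravar; nra).
    rewrite Rinv_1 in *; lra.
Qed.

(** The affine combinations [w = y + lambda z] of the half cotangents of [phi2] and
    [phi3] relative to [phi1] ([z] being their difference) are periodic and solve
    the linear equation. Since [z] has no zero, [w] is uniformly large for [lambda]
    large of the sign of [z]; then [phi1 + 2 atan (/ w)] is a closed solution
    uniformly close to [phi1]. The parameter [W] is the value [w 0], so that distinct
    values of [W] give solutions with distinct initial angles. *)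
Lemma closed_solutions_near (a tau phi1 phi2 phi3 : R -> R) (P : R) :
  0 < P ->
  solution a tau phi1 -> solution a tau phi2 -> solution a tau phi3 ->
  (forall s, cong (phi1 (s + P)) (phi1 s)) ->
  (forall s, cong (phi2 (s + P)) (phi2 s)) ->
  (forall s, cong (phi3 (s + P)) (phi3 s)) ->
  (forall s, ~ cong (phi2 s) (phi1 s)) ->
  (forall s, ~ cong (phi3 s) (phi1 s)) ->
  (forall s, ~ cong (phi2 s) (phi3 s)) ->
  forall eps, 0 < eps ->
  exists W0, 0 < W0 /\ forall W, W0 <= W ->
  exists phi, solution a tau phi /\
    (forall s, cong (phi (s + P)) (phi s)) /\
    (forall s, Rabs (phi s - phi1 s) < eps) /\
    phi 0 = phi1 0 + 2 * atan (/ W).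
Proof.
  intros HP S1 S2 S3 P1 P2 P3 N21 N31 N23 eps Heps.
  set (y := half_cot phi1 phi2); set (z := fun s => half_cot phi1 phi2 s - half_cot phi1 phi3 s).
  assert (Dy : forall s, is_derive y s (a s * (sin (phi1 s) - cos (phi1 s) * y s))).
  { intros s; now apply (half_cot_is_derive a tau). }
  assert (Dz : forall s, is_derive z s (a s * (- cos (phi1 s) * z s))).
  { intros s; pose proof (half_cot_is_derive a tau phi1 phi2 s S1 S2 (N21 s)) as H2.
    pose proof (half_cot_is_derive a tau phi1 phi3 s S1 S3 (N31 s)) as H3.
    unfold z; auto_derive; [repeat split; eexists; [exact H2 | exact H3]|].
    derive_with H2; derive_with H3; ring. }
  assert (Nz : forall s, z s <> 0) by (intros s; now apply half_cot_ne).
  assert (Py : periodic P y) by (intros s; now apply half_cot_cong).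
  assert (Pz : periodic P z) by (intros s; unfold z; now rewrite !(half_cot_cong _ _ s (s + P))).
  assert (Cy : forall s, continuous y s) by (intros s; apply (continuous_of_is_derive _ _ _ (Dy s))).
  assert (Cz : forall s, continuous z s) by (intros s; apply (continuous_of_is_derive _ _ _ (Dz s))).
  destruct (periodic_bounded y P HP Py Cy) as [M HM].
  destruct (periodic_bounded (fun s => z 0 / z s) P HP) as [B HB].
  { intros s; now rewrite Pz. }
  { intros s; apply continuous_mult_R; [apply continuous_const|].
    apply continuous_comp; trivial; now apply continuous_Rinv. }
  assert (Hquot : forall s, 0 < z s / z 0).
  { intros s; apply (nonvanishing_same_sign (fun s => z s / z 0) 0).
    - intros t; apply continuous_mult_R; [trivial | apply continuous_const].
    - intros t; apply Rmult_integral_contrapositive_currified; [|apply Rinv_neq_0_compat]; trivial.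
    - unfold Rdiv; rewrite Rinv_r; trivial; lra. }
  assert (HBpos : 0 < B).
  { specialize (HB 0); revert HB; unfold Rdiv; rewrite Rinv_r, Rabs_R1; trivial; lra. }
  assert (Hlow : forall s, / B <= z s / z 0).
  { intros s; replace (z s / z 0) with (/ (z 0 / z s)) by (field; split; trivial).
    assert (Hq : 0 < z 0 / z s).
    { replace (z 0 / z s) with (/ (z s / z 0)) by (field; split; trivial).
      now apply Rinv_0_lt_compat. }
    apply Rinv_le_contravar; trivial.
    apply Rle_trans with (2 := HB s), Rle_abs. }
  assert (HMpos : 0 <= M) by (apply Rle_trans with (2 := HM 0), Rabs_pos).
  set (K := 4 / eps); assert (HK : 0 < K) by (apply Rdiv_lt_0_compat; lra).
  exists (M + (K + M) * B); split; [nra|]; intros W HW.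
  set (w := fun s => y s + (W - y 0) * (z s / z 0)).
  assert (Hw : forall s, K <= w s).
  { intros s; unfold w.
    assert (H1 : - M <= y s) by (specialize (HM s); revert HM; unfold Rabs; destruct Rcase_abs; lra).
    assert (H2 : y 0 <= M) by (apply Rle_trans with (2 := HM 0), Rle_abs).
    assert (H3 : (K + M) * B * / B <= (W - y 0) * (z s / z 0)).
    { apply Rmult_le_compat; [nra | left; now apply Rinv_0_lt_compat | lra | apply Hlow]. }
    rewrite Rmult_assoc, Rinv_r in H3; lra. }
  exists (fun s => phi1 s + 2 * atan (/ w s)); split; [|split; [|split]].
  - apply solution_of_half_cot; trivial.
    + intros s; specialize (Hw s); lra.
    + intros s; pose proof (Dy s) as H1; pose proof (Dz s) as H2.
      unfold w; auto_derive; [repeat split; eexists; [exact H1 | exact H2]|].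
      derive_with H1; derive_with H2; field; trivial.
  - intros s; replace (w (s + P)) with (w s) by (unfold w; now rewrite Py, Pz).
    destruct (P1 s) as [n ->]; exists n; ring.
  - intros s; specialize (Hw s).
    assert (Hinv : 0 < / w s <= / K).
    { split; [apply Rinv_0_lt_compat; lra | now apply Rinv_le_contravar]. }
    pose proof (atan_le_id (/ w s) ltac:(lra)).
    pose proof (atan_increasing 0 (/ w s) ltac:(lra)) as Hat; rewrite atan_0 in Hat.
    assert (EK : / K = eps / 4) by (unfold K; field; lra).
    apply Rabs_def1; lra.
  - unfold w; unfold Rdiv; rewrite Rinv_r by trivial; f_equal; f_equal; f_equal; f_equal; ring.
Qed.

(** For [W > 0], [2 atan (/ W)] decreases strictly within a half turn, so it meets
    each congruence class at most once. *)
Lemma cong_avoid_finitely_many (x : R) (f : nat -> R) (n : nat) :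
  exists W0, forall W, W0 <= W -> forall j, (j < n)%nat ->
    ~ cong (x + 2 * atan (/ W)) (f j).
Proof.
  induction n as [|n [W0 IH]]; [exists 0; intros; lia|].
  assert (H : exists W1, forall W, W1 <= W -> ~ cong (x + 2 * atan (/ W)) (f n)).
  { destruct (classic (exists W, 0 < W /\ cong (x + 2 * atan (/ W)) (f n))) as [[V [HV HcV]] | Hno].
    - exists (V + 1); intros W HW HcW.
      assert (Hlt : / W < / V) by (apply Rinv_lt_contravar; nra).
      assert (HWpos : 0 < / W) by (apply Rinv_0_lt_compat; lra).
      pose proof (atan_increasing _ _ Hlt).
      pose proof (atan_increasing _ _ HWpos) as Hat; rewrite atan_0 in Hat.
      pose proof (atan_bound (/ V)) as [_ Hb].
      destruct (cong_trans _ _ _ HcV (cong_sym _ _ HcW)) as [k Hk].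
      assert (0 < IZR k < 1) as [Hk0 Hk1] by (split; nra).
      apply (lt_IZR 0) in Hk0; apply (lt_IZR k 1) in Hk1; lia.
    - exists 1; intros W HW HcW; apply Hno; exists W; split; trivial; lra. }
  destruct H as [W1 HW1]; exists (Rmax W0 W1); intros W HW j Hj.
  pose proof (Rmax_l W0 W1); pose proof (Rmax_r W0 W1).
  destruct (Nat.eq_dec j n) as [-> | Hne]; [apply HW1; lra | apply IH; [lra | lia]].
Qed.

(** * Isolated closed lines *)

(** Periodic principal lines and their isolation depend on the surface only through
    the line field [D]; these definitions are the given ones with [D] as a
    parameter. *)
Definition closed_line (L : R) (D : R2 -> R2 -> Prop) (l : R2 -> Prop) : Prop :=
  maximal_integral_curve L D l /\
  exists (g : R -> R2) (T : R), 0 < T /\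
    integral_curve D m_infty p_infty g /\
    (forall t, torus_eq L (g t) (g (t + T))) /\
    l = trace L m_infty p_infty g.

Definition isolated_closed_line (L : R) (D : R2 -> R2 -> Prop) (l : R2 -> Prop) : Prop :=
  closed_line L D l /\
  exists U : R2 -> Prop, open U /\ saturated L U /\
    (forall p, l p -> U p) /\
    forall l', closed_line L D l' -> (forall p, l' p -> U p) -> l' = l.

Lemma closed_graph_line L (a tau phi : R -> R) (P : R) (m : Z) :
  (forall s, continuous a s) -> (forall s, continuous tau s) ->
  periodic L a -> periodic L tau -> P = IZR m * L -> 0 < P ->
  solution a tau phi -> (forall s, cong (phi (s + P)) (phi s)) ->
  closed_line L (slope_field a tau) (graph_line L phi).
Proof.
  intros Ha Htau HLa HLtau EP HP Hphi Hper; split.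
  - now apply (graph_line_maximal L a tau).
  - exists (fun s => (s, phi s)), P; split; [|split; [|split]]; trivial.
    + now apply graph_integral_curve.
    + intros s; destruct (Hper s) as [n Hn]; exists m, n; simpl; rewrite <- EP; auto.
Qed.

Lemma cong_multiple_period (phi : R -> R) (L : R) (Q : nat) (P : R) (k : Z) :
  (forall s, cong (phi (s + INR Q * L)) (phi s)) -> P = IZR k * (INR Q * L) ->
  forall s, cong (phi (s + P)) (phi s).
Proof. intros H ->; intros s; now apply (cong_periodic_Z phi (INR Q * L)). Qed.

(** If the three lines were distinct, the closed solutions of [closed_solutions_near]
    would give closed lines inside any neighborhood of [l1]. One of them differs from
    [l1], because [l1] passes over [s = 0] at only finitely many angles
    modulo full turns. *)
Lemma three_closed_lines_not_isolated L (a tau : R -> R) (l1 l2 l3 : R2 -> Prop) :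
  (forall s, continuous a s) -> (forall s, continuous tau s) ->
  periodic L a -> periodic L tau -> 0 < L ->
  isolated_closed_line L (slope_field a tau) l1 ->
  closed_line L (slope_field a tau) l2 ->
  closed_line L (slope_field a tau) l3 ->
  l1 = l2 \/ l1 = l3 \/ l2 = l3.
Proof.
  intros Ha Htau HLa HLtau HL [[_ [g1 [T1 [HT1 [Hg1 [Hc1 E1]]]]]] [U [HU [Hsat [HlU Hiso]]]]]
    [_ [g2 [T2 [HT2 [Hg2 [Hc2 E2]]]]]] [_ [g3 [T3 [HT3 [Hg3 [Hc3 E3]]]]]].
  destruct (closed_curve_is_graph L a tau g1 T1) as [phi1 [Q1 [S1 [HQ1 [R1 G1]]]]]; trivial.
  destruct (closed_curve_is_graph L a tau g2 T2) as [phi2 [Q2 [S2 [HQ2 [R2' G2]]]]]; trivial.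
  destruct (closed_curve_is_graph L a tau g3 T3) as [phi3 [Q3 [S3 [HQ3 [R3' G3]]]]]; trivial.
  rewrite G1 in E1; rewrite G2 in E2; rewrite G3 in E3; clear G1 G2 G3.
  apply NNPP; intros Hdistinct.
  assert (Hne : forall phi psi l l', solution a tau phi -> solution a tau psi ->
    l = graph_line L phi -> l' = graph_line L psi -> l <> l' -> forall s, ~ cong (phi s) (psi s)).
  { intros phi psi l l' Hphi Hpsi -> -> Hll s Hs; apply Hll, graph_line_eq.
    intros t; now apply (solutions_cong a tau phi psi s t). }
  (* A common period of the three solutions. *)
  pose (Q := (Q1 * Q2 * Q3)%nat).
  assert (HQ : (0 < Q)%nat) by (unfold Q; nia).
  set (P := INR Q * L).
  assert (HP : 0 < P) by (apply Rmult_lt_0_compat; trivial; now apply lt_0_INR).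
  assert (EP : P = IZR (Z.of_nat Q) * L) by (unfold P; now rewrite INR_IZR_INZ).
  assert (Hper1 : forall s, cong (phi1 (s + P)) (phi1 s)).
  { apply (cong_multiple_period phi1 L Q1 P (Z.of_nat (Q2 * Q3))); trivial.
    rewrite <- INR_IZR_INZ; unfold P, Q; rewrite !mult_INR; ring. }
  assert (Hper2 : forall s, cong (phi2 (s + P)) (phi2 s)).
  { apply (cong_multiple_period phi2 L Q2 P (Z.of_nat (Q1 * Q3))); trivial.
    rewrite <- INR_IZR_INZ; unfold P, Q; rewrite !mult_INR; ring. }
  assert (Hper3 : forall s, cong (phi3 (s + P)) (phi3 s)).
  { apply (cong_multiple_period phi3 L Q3 P (Z.of_nat (Q1 * Q2))); trivial.
    rewrite <- INR_IZR_INZ; unfold P, Q; rewrite !mult_INR; ring. }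
  destruct (open_contains_tube U (fun s => (s, phi1 s)) 0 P HU) as [d [Hd Htube]].
  { intros s; split; [apply continuous_id | apply (continuous_solution _ _ _ S1)]. }
  { intros s _; apply HlU; rewrite E1; exists s; repeat split; apply torus_eq_refl. }
  destruct (closed_solutions_near a tau phi1 phi2 phi3 P) with (eps := d)
    as [W0 [HW0 Hfam]]; trivial.
  { apply (Hne phi2 phi1 l2 l1); trivial; intros E; apply Hdistinct; auto. }
  { apply (Hne phi3 phi1 l3 l1); trivial; intros E; apply Hdistinct; auto. }
  { apply (Hne phi2 phi3 l2 l3); trivial; intros E; apply Hdistinct; auto. }
  destruct (cong_avoid_finitely_many (phi1 0) (fun j => phi1 (INR j * L)) Q) as [W1 Havoid].
  destruct (Hfam (Rmax W0 W1) (Rmax_l _ _)) as [phi [Hphi [Hper [Hnear Hphi0]]]].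
  (* A point of the new line over s is moved by a multiple of the period P to one
     over [0, P], where the tube is available. *)
  assert (El : graph_line L phi = l1).
  { apply Hiso.
    - now apply (closed_graph_line L a tau phi P (Z.of_nat Q)).
    - intros p [s [_ [_ Hs]]]; apply (Hsat _ _ Hs).
      destruct (reduce_to_period P s HP) as [k Hk].
      destruct (cong_periodic_Z phi1 P Hper1 k s) as [n Hn].
      apply (Hsat (s + IZR k * P, phi s + IZR n * (2 * PI))).
      + exists (- k * Z.of_nat Q)%Z, (- n)%Z; simpl.
        rewrite mult_IZR, !opp_IZR, EP; split; ring.
      + apply (Htube (s + IZR k * P)); trivial; simpl.
        * now rewrite Rminus_diag, Rabs_R0.
        * rewrite Hn; replace (phi s + IZR n * (2 * PI) - (phi1 s + IZR n * (2 * PI)))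
            with (phi s - phi1 s) by ring; apply Hnear. }
  (* The angles of l1 over s = 0 are those of phi1 at the multiples of L, which
     repeat modulo Q. *)
  assert (Hin : graph_line L phi1 (0, phi 0)).
  { rewrite <- E1, <- El; exists 0; repeat split; apply torus_eq_refl. }
  destruct Hin as [s [_ [_ [m [n [Es En]]]]]]; simpl in Es, En.
  set (M := (- m)%Z); set (j := (M mod Z.of_nat Q)%Z).
  assert (Hj : (0 <= j < Z.of_nat Q)%Z) by (apply Z.mod_pos_bound; lia).
  apply (Havoid (Rmax W0 W1) (Rmax_r _ _) (Z.to_nat j)); [lia|].
  rewrite <- Hphi0; apply cong_trans with (phi1 s); [now exists n|].
  replace s with (INR (Z.to_nat j) * L + IZR (M / Z.of_nat Q) * P).
  - now apply cong_periodic_Z.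
  - rewrite INR_IZR_INZ, Z2Nat.id, EP by lia.
    assert (E : IZR M = IZR (Z.of_nat Q) * IZR (M / Z.of_nat Q) + IZR j).
    { rewrite <- mult_IZR, <- plus_IZR; f_equal; apply Z.div_mod; lia. }
    unfold M in E at 1; rewrite opp_IZR in E.
    replace s with (- IZR m * L) by lra; rewrite E; ring.
Qed.

(** * The field of circles *)

Definition circle_field (p v : R2) : Prop := fst v = 0 /\ snd v <> 0.

Definition circle (L s : R) : R2 -> Prop :=
  trace L m_infty p_infty (fun t => (s, t)).

Lemma circle_integral_curve (s : R) :
  integral_curve circle_field m_infty p_infty (fun t => (s, t)).
Proof.
  assert (HD : Derive2 (fun t => (s, t)) = fun _ => (0, 1)).
  { apply functional_extensionality; intros t; unfold Derive2; simpl.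
    now rewrite Derive_const, Derive_id. }
  split; [exact I|]; intros t _ _; simpl; repeat split.
  - apply (ex_derive_const (K := R_AbsRing) (V := R_NormedModule)).
  - apply (ex_derive_id (K := R_AbsRing)).
  - rewrite HD; apply continuous_const.
  - now rewrite HD.
  - rewrite HD; simpl; lra.
Qed.

Lemma circle_field_fst_constant A B g (t0 t1 : R) :
  integral_curve circle_field A B g ->
  Rbar_lt A t0 -> Rbar_lt t0 B -> Rbar_lt A t1 -> Rbar_lt t1 B ->
  fst (g t1) = fst (g t0).
Proof.
  intros [_ Hg] HA0 HB0 HA1 HB1; apply Rminus_diag_uniq.
  apply (linear_ode_zero (fun t => fst (g t) - fst (g t0)) (fun _ => 0) t0 t1); [|ring].
  intros t Ht; split; [|apply continuous_const].
  destruct (Rbar_between A B t0 t1 t HA0 HB0 HA1 HB1 Ht) as [HA HB].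
  destruct (Hg t HA HB) as [Hx [_ [_ [H0 _]]]].
  set (x := fun u => fst (g u)) in *.
  change (Derive x t = 0) in H0.
  change (is_derive (fun u => x u - x t0) t (0 * (x t - x t0))).
  auto_derive; [exact Hx|].
  change (Derive (fun u => x u) t) with (Derive x t); rewrite H0; ring.
Qed.

Lemma circle_field_trace A B g L (t0 : R) :
  integral_curve circle_field A B g -> Rbar_lt A t0 -> Rbar_lt t0 B ->
  forall p, trace L A B g p -> circle L (fst (g t0)) p.
Proof.
  intros Hg HA0 HB0 p [t [HA [HB Ht]]]; exists (snd (g t)); repeat split.
  rewrite <- (circle_field_fst_constant A B g t0 t), <- surjective_pairing; trivial.
Qed.

Lemma circle_shift L s (m : Z) p :
  circle L (s + IZR m * L) p -> circle L s p.
Proof.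
  intros [t [_ [_ Ht]]]; exists t; repeat split.
  apply torus_eq_trans with (2 := Ht); exists m, 0%Z; simpl; split; ring.
Qed.

Lemma circle_closed_line (L s : R) : closed_line L circle_field (circle L s).
Proof.
  split; [split|].
  - exists m_infty, p_infty, (fun t => (s, t)); split; [apply circle_integral_curve | reflexivity].
  - intros A B g Hg Hsub p Hp.
    destruct (Hsub (s, 0)) as [t0 [HA0 [HB0 [m [n [E _]]]]]].
    { exists 0; repeat split; apply torus_eq_refl. }
    simpl in E.
    apply circle_shift with (- m)%Z.
    replace (s + IZR (- m) * L) with (fst (g t0)) by (rewrite opp_IZR, E; ring).
    now apply (circle_field_trace A B g L t0).
  - exists (fun t => (s, t)), (2 * PI); split; [|split; [|split]]; trivial.
    + pose proof PI_RGT_0; lra.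
    + apply circle_integral_curve.
    + intros t; exists 0%Z, 1%Z; simpl; split; ring.
Qed.

(** A line of this field is a full circle by maximality; by compactness its
    neighborhood contains the nearby parallel circles. *)
Lemma circles_not_isolated (L : R) (l : R2 -> Prop) :
  0 < L -> ~ isolated_closed_line L circle_field l.
Proof.
  intros HL [[[_ Hmax] [g [T [_ [Hg [_ El]]]]]] [U [HU [Hsat [HlU Hiso]]]]].
  set (s0 := fst (g 0)).
  assert (Hl : forall p, l p -> circle L s0 p).
  { rewrite El; exact (circle_field_trace m_infty p_infty g L 0 Hg I I). }
  assert (Hl' : forall p, circle L s0 p -> l p).
  { exact (Hmax _ _ _ (circle_integral_curve s0) Hl). }
  destruct (open_contains_tube U (fun t => (s0, t)) 0 (2 * PI) HU) as [d [Hd Htube]].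
  { intros t; split; [apply continuous_const | apply continuous_id]. }
  { intros t _; apply HlU, Hl'; exists t; repeat split; apply torus_eq_refl. }
  assert (Hpos : 0 < Rmin d L) by now apply Rmin_pos.
  pose proof (Rmin_l d L); pose proof (Rmin_r d L).
  set (e := Rmin d L / 2) in *; assert (He : 0 < e < d /\ e < L) by (unfold e; lra).
  assert (E : circle L (s0 + e) = l).
  { apply Hiso; [apply circle_closed_line|].
    intros p [t [_ [_ Ht]]]; apply (Hsat _ _ Ht).
    destruct (reduce_to_period (2 * PI) t) as [k Hk]; [pose proof PI_RGT_0; lra|].
    apply (Hsat (s0 + e, t + IZR k * (2 * PI))).
    - exists 0%Z, (- k)%Z; simpl; rewrite opp_IZR; split; ring.
    - apply (Htube (t + IZR k * (2 * PI))); trivial; simpl.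
      + replace (s0 + e - s0) with e by ring; rewrite Rabs_right; lra.
      + now rewrite Rminus_diag, Rabs_R0. }
  destruct (Hl (s0 + e, 0)) as [t [_ [_ [m [n [Em _]]]]]].
  { rewrite <- E; exists 0; repeat split; apply torus_eq_refl. }
  simpl in Em.
  assert (0 < IZR m < 1) as [Hm0 Hm1] by (split; nra).
  apply (lt_IZR 0) in Hm0; apply (lt_IZR m 1) in Hm1; lia.
Qed.

(** * Calculus of vector functions *)

Inductive axis : Type := Axis1 | Axis2 | Axis3.

Definition coord (i : axis) (u : R3) : R :=
  match i with Axis1 => fst (fst u) | Axis2 => snd (fst u) | Axis3 => snd u end.

Definition is_derive3 (f : R -> R3) (s : R) (v : R3) : Prop :=
  forall i, is_derive (fun u => coord i (f u)) s (coord i v).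

Lemma coord_ext (u v : R3) : (forall i, coord i u = coord i v) -> u = v.
Proof.
  intros H; pose proof (H Axis1); pose proof (H Axis2); pose proof (H Axis3).
  destruct u as [[]], v as [[]]; simpl in *; congruence.
Qed.

Lemma coord_plus i (u v : R3) : coord i (plus u v) = coord i u + coord i v.
Proof. now destruct i. Qed.

Lemma coord_scal i (k : R) (u : R3) : coord i (scal k u) = k * coord i u.
Proof. now destruct i. Qed.

Lemma coord_minus i (u v : R3) : coord i (minus u v) = coord i u - coord i v.
Proof. now destruct i. Qed.

Lemma coord_Derive3 i (f : R -> R3) s : coord i (Derive3 f s) = Derive (fun u => coord i (f u)) s.
Proof. now destruct i. Qed.

Lemma is_derive3_unique (f : R -> R3) (s : R) (v : R3) : is_derive3 f s v -> Derive3 f s = v.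
Proof.
  intros H; apply coord_ext; intros i; rewrite coord_Derive3; apply is_derive_unique, H.
Qed.

Lemma is_derive3_ext (f g : R -> R3) (s : R) (v w : R3) :
  (forall u, f u = g u) -> v = w -> is_derive3 f s v -> is_derive3 g s w.
Proof.
  intros H <- Hf i; apply (is_derive_ext (fun u => coord i (f u))), Hf.
  intros u; now rewrite H.
Qed.

Lemma is_derive3_plus (f g : R -> R3) (s : R) (u v : R3) :
  is_derive3 f s u -> is_derive3 g s v -> is_derive3 (fun t => plus (f t) (g t)) s (plus u v).
Proof.
  intros Hf Hg i; rewrite coord_plus.
  apply (is_derive_ext (fun t => coord i (f t) + coord i (g t))).
  - intros t; now rewrite coord_plus.
  - exact (is_derive_plus (V := R_NormedModule) _ _ s _ _ (Hf i) (Hg i)).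
Qed.

Lemma is_derive_Rmult (p q : R -> R) (s dp dq : R) :
  is_derive p s dp -> is_derive q s dq ->
  is_derive (fun t => p t * q t) s (dp * q s + p s * dq).
Proof. intros Hp Hq; exact (is_derive_mult p q s dp dq Hp Hq Rmult_comm). Qed.

Lemma is_derive3_scal (h : R -> R) (f : R -> R3) (s dh : R) (u : R3) :
  is_derive h s dh -> is_derive3 f s u ->
  is_derive3 (fun t => scal (h t) (f t)) s (plus (scal dh (f s)) (scal (h s) u)).
Proof.
  intros Hh Hf i; rewrite coord_plus, !coord_scal.
  apply (is_derive_ext (fun t => h t * coord i (f t))).
  - intros t; now rewrite coord_scal.
  - exact (is_derive_Rmult h _ s _ _ Hh (Hf i)).
Qed.

Lemma is_derive_dot (f g : R -> R3) (s : R) (u v : R3) :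
  is_derive3 f s u -> is_derive3 g s v ->
  is_derive (fun t => dot (f t) (g t)) s (dot u (g s) + dot (f s) v).
Proof.
  intros Hf Hg.
  pose proof (fun i => is_derive_Rmult _ _ s _ _ (Hf i) (Hg i)) as H.
  pose proof (is_derive_plus (V := R_NormedModule) _ _ s _ _
    (is_derive_plus (V := R_NormedModule) _ _ s _ _ (H Axis1) (H Axis2)) (H Axis3)) as E.
  replace (dot u (g s) + dot (f s) v) with (plus (plus
    (coord Axis1 u * coord Axis1 (g s) + coord Axis1 (f s) * coord Axis1 v)
    (coord Axis2 u * coord Axis2 (g s) + coord Axis2 (f s) * coord Axis2 v))
    (coord Axis3 u * coord Axis3 (g s) + coord Axis3 (f s) * coord Axis3 v)).
  - exact E.
  - unfold dot, plus; simpl; ring.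
Qed.

Lemma is_derive3_cross (f g : R -> R3) (s : R) (u v : R3) :
  is_derive3 f s u -> is_derive3 g s v ->
  is_derive3 (fun t => cross (f t) (g t)) s (plus (cross u (g s)) (cross (f s) v)).
Proof.
  intros Hf Hg.
  assert (H : forall i j, is_derive (fun t => coord i (f t) * coord j (g t)
                                   - coord j (f t) * coord i (g t)) s
    ((coord i u * coord j (g s) + coord i (f s) * coord j v)
     - (coord j u * coord i (g s) + coord j (f s) * coord i v))).
  { intros i j.
    exact (is_derive_minus (V := R_NormedModule) _ _ s _ _
      (is_derive_Rmult _ _ s _ _ (Hf i) (Hg j)) (is_derive_Rmult _ _ s _ _ (Hf j) (Hg i))). }
  assert (Hswap : forall p q x y : R, (p + q) - (x + y) = (p - x) + (q - y)) by (intros; ring).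
  intros []; rewrite coord_plus; simpl; rewrite <- Hswap.
  - exact (H Axis2 Axis3).
  - exact (H Axis3 Axis1).
  - exact (H Axis1 Axis2).
Qed.

Ltac vector_ring :=
  apply coord_ext; intros ?i;
  repeat (rewrite coord_plus || rewrite coord_scal || rewrite coord_minus); try ring.

(** * The Frenet frame *)

(** The classical formula [det (c', c'', c''') / kappa^2]; as a quotient of
    smooth functions it is visibly continuous. *)
Definition torsion (c : R -> R3) (s : R) : R :=
  dot (Derive3 (Derive3 (tangent c)) s) (binormal c s) / curvature c s.

Lemma smooth3_is_derive3 c s :
  smooth3 c ->
  is_derive3 c s (tangent c s) /\
  is_derive3 (tangent c) s (Derive3 (tangent c) s) /\
  is_derive3 (Derive3 (tangent c)) s (Derive3 (Derive3 (tangent c)) s).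
Proof.
  intros [H1 [H2 H3]].
  split; [|split]; intros []; simpl; apply Derive_correct.
  - exact (H1 1%nat s).
  - exact (H2 1%nat s).
  - exact (H3 1%nat s).
  - exact (H1 2%nat s).
  - exact (H2 2%nat s).
  - exact (H3 2%nat s).
  - exact (H1 3%nat s).
  - exact (H2 3%nat s).
  - exact (H3 3%nat s).
Qed.

Lemma dot_scal_l (k : R) (u v : R3) : dot (scal k u) v = k * dot u v.
Proof. unfold dot; destruct u as [[]], v as [[]]; unfold scal; simpl; unfold scal; simpl; unfold mult; simpl; ring. Qed.

Lemma dot_sym (u v : R3) : dot u v = dot v u.
Proof. unfold dot; ring. Qed.

(** Specialization of a polynomial identity, valid for all [t] and [n], in which the
    left side is multiplied by the Gram determinant of [t] and [n]. *)
Lemma orthonormal_expansion (t n u : R3) :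
  dot t t = 1 -> dot n n = 1 -> dot t n = 0 ->
  u = plus (scal (dot u t) t) (plus (scal (dot u n) n) (scal (dot u (cross t n)) (cross t n))).
Proof.
  intros Ht Hn Htn.
  assert (E : scal (dot t t * dot n n - dot t n * dot t n) u =
    plus (scal (dot u t * dot n n - dot u n * dot t n) t)
   (plus (scal (dot u n * dot t t - dot u t * dot t n) n)
         (scal (dot u (cross t n)) (cross t n)))).
  { apply coord_ext; intros i; rewrite !coord_plus, !coord_scal.
    unfold dot, cross; destruct i; simpl; ring. }
  rewrite Ht, Hn, Htn in E.
  etransitivity; [|etransitivity; [exact E|]]; vector_ring.
Qed.


Lemma curvature_pos L c s : biregular_closed_curve L c -> 0 < curvature c s.
Proof. intros Hc; apply Hc. Qed.

Lemma tangent_unit L c s : biregular_closed_curve L c -> dot (tangent c s) (tangent c s) = 1.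
Proof.
  intros Hc.
  destruct Hc as [_ [_ [_ [H _]]]]; specialize (H s); unfold enorm in H.
  destruct (Rle_dec 0 (dot (tangent c s) (tangent c s))) as [Hp | Hn].
  - rewrite <- (sqrt_sqrt _ Hp), H; ring.
  - rewrite sqrt_neg_0 in H; lra.
Qed.

Lemma curvature_sqr L c s :
  biregular_closed_curve L c ->
  dot (Derive3 (tangent c) s) (Derive3 (tangent c) s) = curvature c s * curvature c s.
Proof.
  intros Hc.
  symmetry; apply sqrt_sqrt; unfold dot; nra.
Qed.

Lemma tangent_acceleration L c s : biregular_closed_curve L c -> dot (tangent c s) (Derive3 (tangent c) s) = 0.
Proof.
  intros Hc.
  destruct (smooth3_is_derive3 c s (proj1 (proj2 Hc))) as [_ [H _]].
  pose proof (is_derive_unique _ _ _ (is_derive_dot _ _ s _ _ H H)) as E.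
  rewrite (Derive_ext _ (fun _ => 1)), Derive_const in E by (intros; now apply (tangent_unit L)).
  rewrite (dot_sym (Derive3 _ _)) in E; lra.
Qed.

Lemma normal_unit L c s : biregular_closed_curve L c -> dot (normal c s) (normal c s) = 1.
Proof.
  intros Hc.
  pose proof (curvature_pos L c s Hc); unfold normal.
  rewrite dot_scal_l, dot_sym, dot_scal_l, (curvature_sqr L c s Hc); field; lra.
Qed.

Lemma tangent_normal L c s : biregular_closed_curve L c -> dot (tangent c s) (normal c s) = 0.
Proof. intros Hc; unfold normal; rewrite dot_sym, dot_scal_l, dot_sym, (tangent_acceleration L c s Hc); ring. Qed.

Lemma curvature_is_derive L c s :
  biregular_closed_curve L c ->
  is_derive (curvature c) s
    (dot (Derive3 (Derive3 (tangent c)) s) (Derive3 (tangent c) s) / curvature c s).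
Proof.
  intros Hc.
  destruct (smooth3_is_derive3 c s (proj1 (proj2 Hc))) as [_ [_ H]].
  pose proof (is_derive_dot _ _ s _ _ H H) as E.
  rewrite (dot_sym (Derive3 (tangent c) s)) in E.
  set (f := fun t => dot (Derive3 (tangent c) t) (Derive3 (tangent c) t)) in *.
  pose proof (curvature_pos L c s Hc) as Hk.
  change (is_derive (fun t => sqrt (f t)) s
    (dot (Derive3 (Derive3 (tangent c)) s) (Derive3 (tangent c) s) / sqrt (f s))).
  change (0 < sqrt (f s)) in Hk.
  assert (Hf : 0 < f s).
  { apply Rnot_le_lt; intros Hle; rewrite (sqrt_neg_0 _ Hle) in Hk; lra. }
  change (is_derive f s (dot (Derive3 (Derive3 (tangent c)) s) (Derive3 (tangent c) s) +
                         dot (Derive3 (Derive3 (tangent c)) s) (Derive3 (tangent c) s))) in E.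
  auto_derive; [repeat split; [eexists; exact E | exact Hf]|].
  derive_with E; field; lra.
Qed.

Lemma tangent_is_derive3 L c s :
  biregular_closed_curve L c ->
  is_derive3 (tangent c) s (scal (curvature c s) (normal c s)).
Proof.
  intros Hc.
  pose proof (curvature_pos L c s Hc).
  apply (is_derive3_ext (tangent c) _ s (Derive3 (tangent c) s)); trivial.
  - unfold normal; vector_ring; field; lra.
  - exact (proj1 (proj2 (smooth3_is_derive3 c s (proj1 (proj2 Hc))))).
Qed.

(** The coordinates of [c'''] along the tangent and the normal are [- kappa^2] and
    [kappa'], by differentiating [t . c'' = 0] and [c'' . c'' = kappa^2]; the remaining
    one is [kappa tau] by definition of the torsion. *)
Lemma normal_is_derive3 L c s :
  biregular_closed_curve L c ->
  is_derive3 (normal c) s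
    (plus (scal (- curvature c s) (tangent c s)) (scal (torsion c s) (binormal c s))).
Proof.
  intros Hc.
  pose proof (curvature_pos L c s Hc) as Hk.
  destruct (smooth3_is_derive3 c s (proj1 (proj2 Hc))) as [_ [Ht HJ]].
  pose proof (curvature_is_derive L c s Hc) as Hdk.
  pose proof (is_derive_inv _ _ _ Hdk ltac:(lra)) as Hinv.
  refine (is_derive3_ext _ _ s _ _ (fun u => eq_refl) _ (is_derive3_scal _ _ s _ _ Hinv HJ)).
  unfold torsion.
  set (A := Derive3 (tangent c) s) in *; set (J := Derive3 (Derive3 (tangent c)) s) in *.
  assert (HJT : dot J (tangent c s) = - (curvature c s * curvature c s)).
  { pose proof (is_derive_unique _ _ _ (is_derive_dot _ _ s _ _ Ht HJ)) as E.
    rewrite (Derive_ext _ (fun _ => 0)), Derive_const in E by (intros; now apply (tangent_acceleration L)).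
    rewrite <- (curvature_sqr L c s Hc); fold A in E |- *; fold J in E; rewrite (dot_sym J); lra. }
  assert (HJN : dot J (normal c s) = dot J A / curvature c s).
  { unfold normal; fold A; rewrite dot_sym, dot_scal_l, dot_sym; field; lra. }
  pose proof (orthonormal_expansion _ _ J (tangent_unit L c s Hc) (normal_unit L c s Hc) (tangent_normal L c s Hc)) as E.
  fold (binormal c s) in E; rewrite HJT, HJN in E.
  assert (EA : A = scal (curvature c s) (normal c s)).
  { unfold normal; fold A; vector_ring; field; lra. }
  apply coord_ext; intros i.
  apply (f_equal (coord i)) in E; apply (f_equal (coord i)) in EA.
  rewrite !coord_plus, !coord_scal in *.
  rewrite E, EA; field; lra.
Qed.

Lemma binormal_is_derive3 L c s :
  biregular_closed_curve L c ->
  is_derive3 (binormal c) s (scal (- torsion c s) (normal c s)).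
Proof.
  intros Hc.
  refine (is_derive3_ext _ _ s _ _ (fun u => eq_refl) _
    (is_derive3_cross _ _ s _ _ (tangent_is_derive3 L c s Hc) (normal_is_derive3 L c s Hc))).
  pose proof (tangent_unit L c s Hc) as H1; pose proof (tangent_normal L c s Hc) as H2.
  unfold binormal.
  set (t := tangent c s) in *; set (n := normal c s) in *.
  set (k := curvature c s); set (w := torsion c s).
  transitivity (plus (scal (w * dot t n) t) (scal (- w * dot t t) n)).
  - destruct t as [[]], n as [[]]; apply coord_ext; intros [];
      rewrite ?coord_plus, ?coord_scal; unfold dot, cross; simpl;
      unfold plus, scal; simpl; unfold plus, scal; simpl; unfold mult; simpl; ring.
  - rewrite H1, H2; vector_ring.
Qed.

(** The vector with coordinates [(x, y, z)] in the Frenet frame at [c s]. *)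
Definition frame_comb (c : R -> R3) (s x y z : R) : R3 :=
  plus (scal x (tangent c s)) (plus (scal y (normal c s)) (scal z (binormal c s))).

Lemma frame_comb_eq_0 L c s x y z :
  biregular_closed_curve L c -> frame_comb c s x y z = (0, 0, 0) -> x = 0 /\ y = 0 /\ z = 0.
Proof.
  intros Hc H.
  pose proof (tangent_unit L c s Hc) as H1; pose proof (normal_unit L c s Hc) as H2;
  pose proof (tangent_normal L c s Hc) as H3.
  unfold frame_comb, binormal in H.
  set (t := tangent c s) in *; set (n := normal c s) in *.
  assert (Et : dot (plus (scal x t) (plus (scal y n) (scal z (cross t n)))) t
               = x * dot t t + y * dot t n).
  { unfold dot, cross; destruct t as [[]], n as [[]];
      unfold plus, scal; simpl; unfold plus, scal; simpl; unfold plus, scal, mult; simpl; ring. }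
  assert (En : dot (plus (scal x t) (plus (scal y n) (scal z (cross t n)))) n
               = x * dot t n + y * dot n n).
  { unfold dot, cross; destruct t as [[]], n as [[]];
      unfold plus, scal; simpl; unfold plus, scal; simpl; unfold plus, scal, mult; simpl; ring. }
  assert (Eb : dot (plus (scal x t) (plus (scal y n) (scal z (cross t n)))) (cross t n)
               = z * (dot t t * dot n n - dot t n * dot t n)).
  { unfold dot, cross; destruct t as [[]], n as [[]];
      unfold plus, scal; simpl; unfold plus, scal; simpl; unfold plus, scal, mult; simpl; ring. }
  rewrite H in Et, En, Eb; rewrite H1, H2, H3 in *.
  unfold dot in Et, En, Eb; simpl in Et, En, Eb; repeat split; lra.
Qed.

(** The Frenet formulas, for a vector given by its coordinates in the frame. *)
Lemma moving_frame_is_derive3 L c (x y z : R -> R) (s dx dy dz : R) :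
  biregular_closed_curve L c ->
  is_derive x s dx -> is_derive y s dy -> is_derive z s dz ->
  is_derive3 (fun u => frame_comb c u (x u) (y u) (z u)) s
    (frame_comb c s (dx - curvature c s * y s)
              (dy + curvature c s * x s - torsion c s * z s)
              (dz + torsion c s * y s)).
Proof.
  intros Hc Hx Hy Hz.
  refine (is_derive3_ext _ _ s _ _ (fun u => eq_refl) _
    (is_derive3_plus _ _ s _ _ (is_derive3_scal x _ s _ _ Hx (tangent_is_derive3 L c s Hc))
      (is_derive3_plus _ _ s _ _ (is_derive3_scal y _ s _ _ Hy (normal_is_derive3 L c s Hc))
         (is_derive3_scal z _ s _ _ Hz (binormal_is_derive3 L c s Hc))))).
  unfold frame_comb; vector_ring.
Qed.

Lemma fixed_frame_is_derive3 c (s : R) (x y z : R -> R) (p dx dy dz : R) :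
  is_derive x p dx -> is_derive y p dy -> is_derive z p dz ->
  is_derive3 (fun u => frame_comb c s (x u) (y u) (z u)) p (frame_comb c s dx dy dz).
Proof.
  intros Hx Hy Hz i.
  apply (is_derive_ext (fun u => x u * coord i (tangent c s) +
    (y u * coord i (normal c s) + z u * coord i (binormal c s)))).
  { intros u; unfold frame_comb; now rewrite !coord_plus, !coord_scal. }
  unfold frame_comb; rewrite !coord_plus, !coord_scal.
  auto_derive; [repeat split; eexists; eassumption|].
  derive_with Hx; derive_with Hy; derive_with Hz; ring.
Qed.

(** * The canal surface in the Frenet frame *)

Lemma canal_frame c r theta s phi :
  canal c r theta (s, phi) = plus (c s) (frame_comb c s (r s * cos (theta s))
    (r s * sin (theta s) * cos phi) (r s * sin (theta s) * sin phi)).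
Proof. unfold canal, frame_comb; vector_ring. Qed.

Lemma inward_normal_frame c r theta s phi :
  r s <> 0 ->
  inward_normal c r theta (s, phi) = frame_comb c s (- cos (theta s))
    (- sin (theta s) * cos phi) (- sin (theta s) * sin phi).
Proof.
  intros Hr; unfold inward_normal; rewrite canal_frame; unfold frame_comb; simpl fst.
  vector_ring; field; trivial.
Qed.

Lemma differential_inward_normal L (c : R -> R3) (r theta : R -> R) (s phi v1 v2 dtheta : R) :
  biregular_closed_curve L c -> (forall u, 0 < r u) -> is_derive theta s dtheta ->
  differential (inward_normal c r theta) (s, phi) (v1, v2) =
  frame_comb c s
    (v1 * sin (theta s) * (dtheta + curvature c s * cos phi))
    (v1 * (- cos (theta s) * dtheta * cos phi - curvature c s * cos (theta s)
           + torsion c s * sin (theta s) * sin phi) + v2 * sin (theta s) * sin phi)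
    (v1 * (- cos (theta s) * dtheta * sin phi - torsion c s * sin (theta s) * cos phi)
     - v2 * sin (theta s) * cos phi).
Proof.
  intros Hc Hr Ht; unfold differential; simpl fst; simpl snd.
  assert (Es : Derive3 (fun u => inward_normal c r theta (u, phi)) s = frame_comb c s
    (sin (theta s) * dtheta - curvature c s * (- sin (theta s) * cos phi))
    (- cos (theta s) * dtheta * cos phi + curvature c s * - cos (theta s)
      - torsion c s * (- sin (theta s) * sin phi))
    (- cos (theta s) * dtheta * sin phi + torsion c s * (- sin (theta s) * cos phi))).
  { apply is_derive3_unique.
    refine (is_derive3_ext (fun u => frame_comb c u (- cos (theta u))
      (- sin (theta u) * cos phi) (- sin (theta u) * sin phi)) _ s _ _ _ eq_refl _).
    { intros u; specialize (Hr u); rewrite inward_normal_frame; trivial; lra. }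
    apply (moving_frame_is_derive3 L c (fun u => - cos (theta u))
      (fun u => - sin (theta u) * cos phi) (fun u => - sin (theta u) * sin phi)); trivial;
      (auto_derive; [eexists; exact Ht | derive_with Ht; ring]). }
  assert (Ep : Derive3 (fun u => inward_normal c r theta (s, u)) phi = frame_comb c s
    0 (sin (theta s) * sin phi) (- sin (theta s) * cos phi)).
  { apply is_derive3_unique.
    refine (is_derive3_ext (fun u => frame_comb c s (- cos (theta s))
      (- sin (theta s) * cos u) (- sin (theta s) * sin u)) _ phi _ _ _ eq_refl _).
    { intros u; specialize (Hr s); rewrite inward_normal_frame; trivial; lra. }
    apply (fixed_frame_is_derive3 c s (fun _ => - cos (theta s))); auto_derive; trivial; ring. }
  rewrite Es, Ep; unfold frame_comb; vector_ring.
Qed.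

Lemma differential_canal L (c : R -> R3) (r theta : R -> R) (s phi v1 v2 dr dtheta : R) :
  biregular_closed_curve L c -> is_derive r s dr -> is_derive theta s dtheta ->
  differential (canal c r theta) (s, phi) (v1, v2) =
  frame_comb c s
    (v1 * (1 + dr * cos (theta s) - r s * sin (theta s) * (dtheta + curvature c s * cos phi)))
    (v1 * ((dr * sin (theta s) + r s * cos (theta s) * dtheta) * cos phi
           + curvature c s * r s * cos (theta s)
           - torsion c s * r s * sin (theta s) * sin phi) - v2 * r s * sin (theta s) * sin phi)
    (v1 * ((dr * sin (theta s) + r s * cos (theta s) * dtheta) * sin phi
           + torsion c s * r s * sin (theta s) * cos phi) + v2 * r s * sin (theta s) * cos phi).
Proof.
  intros Hc Hr Ht; unfold differential; simpl fst; simpl snd.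
  assert (Es : Derive3 (fun u => canal c r theta (u, phi)) s = plus (tangent c s) (frame_comb c s
    (dr * cos (theta s) - r s * sin (theta s) * dtheta
      - curvature c s * (r s * sin (theta s) * cos phi))
    ((dr * sin (theta s) + r s * cos (theta s) * dtheta) * cos phi
      + curvature c s * (r s * cos (theta s)) - torsion c s * (r s * sin (theta s) * sin phi))
    ((dr * sin (theta s) + r s * cos (theta s) * dtheta) * sin phi
      + torsion c s * (r s * sin (theta s) * cos phi)))).
  { apply is_derive3_unique.
    refine (is_derive3_ext (fun u => plus (c u) (frame_comb c u (r u * cos (theta u))
      (r u * sin (theta u) * cos phi) (r u * sin (theta u) * sin phi))) _ s _ _ _ eq_refl _).
    { intros u; now rewrite canal_frame. }
    apply is_derive3_plus; [exact (proj1 (smooth3_is_derive3 c s (proj1 (proj2 Hc))))|].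
    apply (moving_frame_is_derive3 L c (fun u => r u * cos (theta u))
      (fun u => r u * sin (theta u) * cos phi) (fun u => r u * sin (theta u) * sin phi)); trivial;
      (auto_derive; [repeat split; eexists; eassumption | derive_with Ht; derive_with Hr; ring]). }
  assert (Ep : Derive3 (fun u => canal c r theta (s, u)) phi = frame_comb c s
    0 (- r s * sin (theta s) * sin phi) (r s * sin (theta s) * cos phi)).
  { apply is_derive3_unique.
    refine (is_derive3_ext _ _ phi _ _ (fun u => eq_sym (canal_frame c r theta s u)) _
      (is_derive3_plus (fun _ => c s) _ phi (0, 0, 0) _ _
        (fixed_frame_is_derive3 c s (fun _ => r s * cos (theta s)) (fun u => r s * sin (theta s) * cos u)
          (fun u => r s * sin (theta s) * sin u) phi 0 (- r s * sin (theta s) * sin phi)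
          (r s * sin (theta s) * cos phi) _ _ _))).
    - apply coord_ext; intros []; rewrite coord_plus; simpl; ring.
    - intros []; simpl; auto_derive; trivial.
    - auto_derive; trivial.
    - auto_derive; trivial; ring.
    - auto_derive; trivial; ring. }
  rewrite Es, Ep; unfold frame_comb; vector_ring.
Qed.

(** Along [d/ds] the inward normal has derivative [sin theta] times this number in
    the direction of the tangent of [c]. *)
Definition normal_turning (c : R -> R3) (theta : R -> R) (s phi : R) : R :=
  Derive theta s + curvature c s * cos phi.

(** Differentiating [cos theta = - r'] gives [r'' = theta' sin theta], which turns the
    immersion condition into [r kappa < sin theta - r theta']; the last inequality
    follows because [cos phi <= 1]. *)
Lemma canal_pointwise_facts L (c : R -> R3) (r theta : R -> R) (s : R) :
  immersed_canal_surface L c r theta ->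
  0 < r s /\ 0 < sin (theta s) /\ is_derive r s (- cos (theta s)) /\
  is_derive theta s (Derive theta s) /\
  forall phi, 0 < sin (theta s) - r s * normal_turning c theta s phi.
Proof.
  intros [Hc [Sr [_ [Hr [St [_ [Ht [Hcos Him]]]]]]]].
  specialize (Hr s); specialize (Ht s).
  assert (Hsin : 0 < sin (theta s)) by (apply sin_gt_0; lra).
  assert (Dr : is_derive r s (- cos (theta s))).
  { rewrite Hcos, Ropp_involutive; exact (Derive_correct r s (Sr 1%nat s)). }
  assert (Dt : is_derive theta s (Derive theta s)) by exact (Derive_correct theta s (St 1%nat s)).
  refine (conj Hr (conj Hsin (conj Dr (conj Dt _)))); intros phi.
  assert (Er2 : Derive_n r 2 s = sin (theta s) * Derive theta s).
  { change (Derive (Derive r) s = sin (theta s) * Derive theta s).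
    rewrite (Derive_ext _ (fun u => - cos (theta u))) by (intros u; rewrite Hcos; ring).
    apply is_derive_unique; auto_derive; [eexists; exact Dt|].
    derive_with Dt; ring. }
  specialize (Him s).
  assert (Edr : Derive r s = - cos (theta s)) by (rewrite Hcos; ring).
  rewrite Er2, Edr in Him.
  pose proof (sin2_cos2 (theta s)) as Hp; unfold Rsqr in Hp.
  assert (Esq : sqrt (1 - (- cos (theta s)) ^ 2) = sin (theta s)).
  { replace (1 - (- cos (theta s)) ^ 2) with (sin (theta s) * sin (theta s)) by (rewrite <- Hp at 1; ring).
    apply sqrt_square; lra. }
  rewrite Esq in Him.
  apply (Rmult_lt_compat_r (r s * sin (theta s))) in Him; [|now apply Rmult_lt_0_compat].
  unfold Rdiv in Him; rewrite Rmult_assoc, Rinv_l, Rmult_1_r in Him by (apply Rgt_not_eq, Rmult_lt_0_compat; trivial).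
  assert (Hcp : curvature c s * cos phi <= curvature c s).
  { pose proof (COS_bound phi); pose proof (curvature_pos L c s Hc); nra. }
  unfold normal_turning.
  assert (0 < sin (theta s) * (sin (theta s) - r s * (Derive theta s + curvature c s * cos phi))).
  { assert (curvature c s * cos phi * (r s * sin (theta s)) <= curvature c s * (r s * sin (theta s))).
    { apply Rmult_le_compat_r; trivial; left; now apply Rmult_lt_0_compat. }
    nra. }
  nra.
Qed.

(** The coefficient [kappa cot(theta)] of the slope equation. *)
Definition curvature_cot (c : R -> R3) (theta : R -> R) (s : R) : R :=
  curvature c s * cos (theta s) / sin (theta s).

(** Both derivatives are tangent to the surface, so the vector equation has two
    independent coordinates: along the direction [sin theta t - cos theta (cos phi n
    + sin phi b)], orthogonal to the circle, and along the circle. They are the two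
    scalar expressions below, the second one up to the factor [sin theta]. In the
    proof [EX], [EY] and [EZ] give the Frenet coordinates in terms of these two. *)
Lemma principal_direction_iff L (c : R -> R3) (r theta : R -> R) (s phi v1 v2 k : R) :
  immersed_canal_surface L c r theta ->
  principal_direction c r theta (s, phi) (v1, v2) k <->
  (v1, v2) <> (0, 0) /\
  v1 * (normal_turning c theta s phi + k * (sin (theta s) - r s * normal_turning c theta s phi)) = 0 /\
  (k * r s - 1) * (v2 - v1 * (curvature_cot c theta s * sin phi - torsion c s)) = 0.
Proof.
  intros H; pose proof (canal_pointwise_facts L c r theta s H) as [Hr [Hs [Dr [Dt _]]]].
  destruct H as [Hc [_ [_ [Hrpos _]]]].
  unfold principal_direction, curvature_cot.
  rewrite (differential_inward_normal L c r theta s phi v1 v2 _ Hc Hrpos Dt),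
    (differential_canal L c r theta s phi v1 v2 _ _ Hc Dr Dt).
  match goal with |- (_ /\ plus (frame_comb _ _ ?x ?y ?z) (scal k (frame_comb _ _ ?x' ?y' ?z')) = _) <-> _ =>
    assert (E : plus (frame_comb c s x y z) (scal k (frame_comb c s x' y' z')) =
                frame_comb c s (x + k * x') (y + k * y') (z + k * z'))
      by (unfold frame_comb; vector_ring)
  end.
  rewrite E; clear E.
  pose proof (sin2_cos2 (theta s)) as Hp; pose proof (sin2_cos2 phi) as Hq; unfold Rsqr in Hp, Hq.
  unfold normal_turning; set (e := Derive theta s + curvature c s * cos phi).
  assert (Ee : Derive theta s = e - curvature c s * cos phi) by (unfold e; ring).
  rewrite Ee; set (K := curvature c s) in *; set (w := torsion c s).
  match goal with |- (_ /\ frame_comb _ _ ?x ?y ?z = _) <-> _ =>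
    set (X := x); set (Y := y); set (Z := z) end.
  set (A := e + k * (sin (theta s) - r s * e)).
  set (be := v2 - v1 * (K * cos (theta s) / sin (theta s) * sin phi - w)).
  assert (EX : X = sin (theta s) * (v1 * A)).
  { unfold X, A.
    replace (1 + - cos (theta s) * cos (theta s)) with (sin (theta s) * sin (theta s)) by (rewrite <- Hp; ring).
    ring. }
  assert (EY : Y = - (cos (theta s) * cos phi) * (v1 * A) - sin (theta s) * sin phi * ((k * r s - 1) * be)).
  { transitivity (- (cos (theta s) * cos phi) * (v1 * A)
      - sin (theta s) * sin phi * ((k * r s - 1) * be)
      + (k * r s - 1) * v1 * K * cos (theta s) * (1 - (sin phi * sin phi + cos phi * cos phi)));
      [unfold Y, A, be; field; lra | rewrite Hq; ring]. }
  assert (EZ : Z = - (cos (theta s) * sin phi) * (v1 * A) + sin (theta s) * cos phi * ((k * r s - 1) * be)).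
  { unfold Z, A, be; field; lra. }
  split; intros [Hv H]; split; trivial.
  - apply (frame_comb_eq_0 L) in H; trivial; destruct H as [H1 [H2 H3]].
    rewrite EX in H1; apply Rmult_integral in H1; destruct H1 as [H1 | H1]; [lra|].
    split; trivial; rewrite EY, H1 in H2; rewrite EZ, H1 in H3.
    assert (H4 : sin (theta s) * ((k * r s - 1) * be) * (sin phi * sin phi + cos phi * cos phi) = 0)
      by (transitivity (cos phi * (- (cos (theta s) * sin phi) * 0 + sin (theta s) * cos phi * ((k * r s - 1) * be))
           - sin phi * (- (cos (theta s) * cos phi) * 0 - sin (theta s) * sin phi * ((k * r s - 1) * be)));
          [ring | rewrite H2, H3; ring]).
    rewrite Hq, Rmult_1_r in H4; apply Rmult_integral in H4; destruct H4; trivial; lra.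
  - destruct H as [H1 H2].
    rewrite EX, EY, EZ, H1, H2.
    unfold frame_comb; vector_ring; destruct i; simpl; ring.
Qed.

(** The difference of the two curvatures is [sin theta / (r A)], where [A > 0] is the
    quantity of [canal_pointwise_facts]. *)
Lemma principal_directions_split L c r theta (s phi : R) :
  immersed_canal_surface L c r theta ->
  exists k1 k2, k2 < k1 /\
    (forall v k, principal_direction c r theta (s, phi) v k <->
       (circle_field (s, phi) v /\ k = k1) \/
       (slope_field (curvature_cot c theta) (torsion c) (s, phi) v /\ k = k2)).
Proof.
  intros H.
  pose proof (canal_pointwise_facts L c r theta s H) as [Hr [Hs [_ [_ HA]]]].
  specialize (HA phi).
  set (e := normal_turning c theta s phi) in *.
  exists (/ r s), (- e / (sin (theta s) - r s * e)); split.
  - apply Rlt_0_minus.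
    replace (/ r s - - e / (sin (theta s) - r s * e))
      with (sin (theta s) / (r s * (sin (theta s) - r s * e))) by (field; lra).
    apply Rdiv_lt_0_compat; trivial; now apply Rmult_lt_0_compat.
  - intros [v1 v2] k; rewrite (principal_direction_iff L) by exact H; fold e.
    unfold circle_field, slope_field; simpl.
    set (f := curvature_cot c theta s * sin phi - torsion c s).
    split.
    + intros [Hv [H1 H2]]; destruct (Req_dec v1 0) as [-> | Hv1].
      * left; assert (Hv2 : v2 <> 0) by (intros ->; now apply Hv).
        repeat split; trivial.
        rewrite Rmult_0_l, Rminus_0_r in H2.
        apply Rmult_integral in H2; destruct H2 as [H2 | H2]; [|contradiction].
        apply Rmult_eq_reg_r with (r s); [field_simplify; lra | lra].
      * right; apply Rmult_integral in H1; destruct H1 as [H1 | H1]; [contradiction|].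
        assert (Hk : k = - e / (sin (theta s) - r s * e)).
        { apply Rmult_eq_reg_r with (sin (theta s) - r s * e); [|lra].
          field_simplify; lra. }
        repeat split; trivial.
        apply Rmult_integral in H2; destruct H2 as [H2 | H2]; [exfalso | lra].
        assert (Hkr : k * r s = 1) by lra.
        assert (E : r s * (e + k * (sin (theta s) - r s * e)) = sin (theta s)).
        { transitivity (r s * e + (k * r s) * (sin (theta s) - r s * e)); [ring|].
          rewrite Hkr; ring. }
        rewrite H1 in E; lra.
    + intros [[[-> Hv2] ->] | [[Hv1 ->] ->]]; (split; [intros E; injection E; intros; contradiction|]).
      * split; [ring | field; lra].
      * split; [field; lra | ring].
Qed.

Lemma foliation_direction_fields L c r theta :
  immersed_canal_surface L c r theta ->
  foliation_direction c r theta Maximal = circle_field /\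
  foliation_direction c r theta Minimal = slope_field (curvature_cot c theta) (torsion c).
Proof.
  intros H; split; apply functional_extensionality; intros [s phi];
    apply functional_extensionality; intros v; apply propositional_extensionality;
    destruct (principal_directions_split L c r theta s phi H) as [k1 [k2 [Hk Hpd]]];
    unfold foliation_direction, principal_curvature.
  - split.
    + intros [k [Hv Hmax]]; apply Hpd in Hv; destruct Hv as [[Hv _] | [_ ->]]; trivial; exfalso.
      enough (k1 <= k2) by lra; apply Hmax; exists (0, 1); apply Hpd; left.
      split; trivial; split; simpl; [reflexivity | lra].
    + intros Hv; exists k1; split; [apply Hpd; now left|].
      intros k [v' Hv']; apply Hpd in Hv'; destruct Hv' as [[_ ->] | [_ ->]]; lra.
  - split.
    + intros [k [Hv Hmin]]; apply Hpd in Hv; destruct Hv as [[_ ->] | [Hv _]]; trivial; exfalso.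
      enough (k1 <= k2) by lra; apply Hmin.
      exists (1, curvature_cot c theta s * sin phi - torsion c s); apply Hpd; right.
      split; trivial; split; simpl; [lra | ring].
    + intros Hv; exists k2; split; [apply Hpd; now right|].
      intros k [v' Hv']; apply Hpd in Hv'; destruct Hv' as [[_ ->] | [_ ->]]; lra.
Qed.

(** Stated on the difference quotients, so it holds for every function. *)
Lemma Derive_periodic (f : R -> R) (L x : R) :
  (forall u, f (u + L) = f u) -> Derive f (x + L) = Derive f x.
Proof.
  intros H; unfold Derive; f_equal; apply Lim_ext; intros h.
  replace (x + L + h) with (x + h + L) by ring; now rewrite !H.
Qed.

Lemma Derive3_periodic (f : R -> R3) (L : R) : periodic L f -> periodic L (Derive3 f).
Proof.
  intros H x; apply coord_ext; intros i; rewrite !coord_Derive3.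
  apply Derive_periodic; intros u; now rewrite H.
Qed.

Lemma curvature_torsion_periodic L c :
  periodic L c -> periodic L (curvature c) /\ periodic L (torsion c).
Proof.
  intros Hc; assert (HT : periodic L (tangent c)) by now apply Derive3_periodic.
  pose proof (Derive3_periodic _ L HT) as HA; pose proof (Derive3_periodic _ L HA) as HJ.
  assert (Hk : periodic L (curvature c)) by (intros s; unfold curvature; now rewrite (HA s)).
  split; trivial; intros s; unfold torsion, binormal, normal.
  rewrite (HJ s), (HA s), (HT s), Hk; reflexivity.
Qed.

Lemma torsion_continuous L c s : biregular_closed_curve L c -> continuous (torsion c) s.
Proof.
  intros Hc.
  assert (HJ : is_derive3 (Derive3 (Derive3 (tangent c))) s
                 (Derive3 (Derive3 (Derive3 (tangent c))) s)).
  { destruct Hc as [_ [[H1 [H2 H3]] _]]; intros []; simpl; apply Derive_correct;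
      [exact (H1 4%nat s) | exact (H2 4%nat s) | exact (H3 4%nat s)]. }
  pose proof (curvature_pos L c s Hc).
  apply continuous_mult_R.
  - exact (continuous_of_is_derive _ _ _
      (is_derive_dot _ _ s _ _ HJ (binormal_is_derive3 L c s Hc))).
  - apply continuous_comp; [|apply continuous_Rinv; lra].
    exact (continuous_of_is_derive _ _ _ (curvature_is_derive L c s Hc)).
Qed.

Theorem mainTheorem3 :
  forall (L : R) (c : R -> R3) (r theta : R -> R),
    immersed_canal_surface L c r theta ->
    forall (F1 F2 F3 : foliation) (l1 l2 l3 : R2 -> Prop),
      isolated_periodic_principal_line L c r theta F1 l1 ->
      isolated_periodic_principal_line L c r theta F2 l2 ->
      isolated_periodic_principal_line L c r theta F3 l3 ->
      (F1, l1) = (F2, l2) \/ (F1, l1) = (F3, l3) \/ (F2, l2) = (F3, l3).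
Proof.
  intros L c r theta H F1 F2 F3 l1 l2 l3.
  destruct (foliation_direction_fields L c r theta H) as [HM Hm].
  pose proof H as [Hc [_ [_ [_ [_ [Pt _]]]]]]; pose proof Hc as [HL [_ [Pc _]]].
  destruct (curvature_torsion_periodic L c Pc) as [Pk Pw].
  assert (Hmin : forall F l, isolated_periodic_principal_line L c r theta F l ->
    F = Minimal /\ isolated_closed_line L (slope_field (curvature_cot c theta) (torsion c)) l).
  { intros F l Hl; change (isolated_closed_line L (foliation_direction c r theta F) l) in Hl.
    destruct F.
    - rewrite HM in Hl; now apply circles_not_isolated in Hl.
    - rewrite Hm in Hl; now split. }
  intros H1 H2 H3.
  destruct (Hmin _ _ H1) as [-> I1]; destruct (Hmin _ _ H2) as [-> [I2 _]];
    destruct (Hmin _ _ H3) as [-> [I3 _]].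
  destruct (three_closed_lines_not_isolated L (curvature_cot c theta) (torsion c) l1 l2 l3)
    as [-> | [-> | ->]]; auto.
  - intros s; destruct (canal_pointwise_facts L c r theta s H) as [_ [Hs [_ [Dt _]]]].
    destruct (continuous_trig_comp theta s (continuous_of_is_derive _ _ _ Dt)) as [Cs Cc].
    apply continuous_mult_R; [apply continuous_mult_R|]; trivial.
    + exact (continuous_of_is_derive _ _ _ (curvature_is_derive L c s Hc)).
    + apply continuous_comp; trivial; apply continuous_Rinv; lra.
  - intros s; now apply (torsion_continuous L).
  - intros s; unfold curvature_cot; now rewrite Pk, Pt.
Qed.
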